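(* Given a set $S$ of $n\ge3$ points in the plane, a speed $v>1$, and $\varepsilon>0$, one can compute in $O(\log(1/\varepsilon)\,\alpha(n)\,n\log n)$ time an axis-aligned speed-$v$ highway cross whose travel-time diameter for $S$ (under the $L_1$-metric) is at most $(2+\varepsilon)$ times that of an optimal axis-aligned speed-$v$ highway cross. Here $\alpha$ is the inverse Ackermann function.
   Context: An axis-aligned highway cross is the union $H$ of a horizontal and a vertical line; one travels with speed $1$ off $H$ with lengths measured in the $L_1$-metric, and with speed $v$ along either line of $H$. The travel time $t_H(p,q)$ is the minimum time of a path from $p$ to $q$; the travel-time diameter of $S$ is $\max_{p,q\in S}t_H(p,q)$, and an optimal highway cross minimizes it. *)

(* Defs.v *)
From Stdlib Require Import Reals Lra List ZArith.
From Coquelicot Require Import Coquelicot.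
Open Scope R_scope.

Definition point := (R * R)%type.

Definition l1 (p q : point) : R := Rabs (fst p - fst q) + Rabs (snd p - snd q).

(* An axis-aligned highway cross: the union of the vertical line x = hx
   and the horizontal line y = hy. *)
Record cross := mkCross { hx : R; hy : R }.

Definition seg_time (H : cross) (v : R) (p q : point) : R :=
  if Req_EM_T (fst p) (hx H) then
    if Req_EM_T (fst q) (hx H) then l1 p q / v else
    if Req_EM_T (snd p) (hy H) then
      if Req_EM_T (snd q) (hy H) then l1 p q / v else l1 p q
    else l1 p q
  else if Req_EM_T (snd p) (hy H) then
    if Req_EM_T (snd q) (hy H) then l1 p q / v else l1 p q
  else l1 p q.

Fixpoint path_time (H : cross) (v : R) (p : point) (ws : list point) (q : point) : R :=
  match ws with
  | nil => seg_time H v p q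
  | w :: ws' => seg_time H v p w + path_time H v w ws' q
  end.

Definition travel_time (H : cross) (v : R) (p q : point) : R :=
  real (Glb_Rbar (fun t => exists ws, t = path_time H v p ws q)).

Definition diam (H : cross) (v : R) (S : list point) : R :=
  fold_right Rmax 0 (map (fun pq => travel_time H v (fst pq) (snd pq)) (list_prod S S)).

Fixpoint ack (m : nat) : nat -> nat :=
  match m with
  | O => S
  | S m' => fix ackm (n : nat) : nat :=
      match n with
      | O => ack m' 1
      | S n' => ack m' (ackm n')
      end
  end.

(* alpha(n) = least k with A(k,k) >= n  (the search up to n suffices). *)
Definition inv_ack (n : nat) : nat :=
  (fix go (k fuel : nat) : nat :=
     match fuel with
     | O => k
     | S f => if Nat.leb n (ack k k) then k else go (S k) f
     end) O (S n).

Inductive instr :=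
| IConst (d : nat) (z : Z)
| IAdd (d s1 s2 : nat)
| ISub (d s1 s2 : nat)
| IHalf (d s : nat)
| ILoad (d a : nat)
| IStore (a s : nat)
| IJlt (s1 s2 t : nat)
| RConst (d : nat) (z : Z)
| RofI (d s : nat)
| RAdd (d s1 s2 : nat)
| RSub (d s1 s2 : nat)
| RMul (d s1 s2 : nat)
| RDiv (d s1 s2 : nat)                  (* division; x/0 := 0 *)
| RLoad (d a : nat)
| RStore (a s : nat)
| RJlt (s1 s2 t : nat)
| Jmp (t : nat)
| Halt.

Definition program := list instr.

Record config := mkConfig { pc : nat; im : nat -> Z; rm : nat -> R }.

Definition updZ (f : nat -> Z) (i : nat) (z : Z) : nat -> Z :=
  fun j => if Nat.eqb j i then z else f j.
Definition updR (f : nat -> R) (i : nat) (x : R) : nat -> R :=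
  fun j => if Nat.eqb j i then x else f j.

Definition rdiv (x y : R) : R := if Req_EM_T y 0 then 0 else x / y.

Definition step (P : program) (c : config) : option config :=
  let p := pc c in let IM := im c in let M := rm c in
  match nth_error P p with
  | None => None
  | Some Halt => None
  | Some i => Some
    match i with
    | IConst d z => mkConfig (S p) (updZ IM d z) M
    | IAdd d a b => mkConfig (S p) (updZ IM d (IM a + IM b)%Z) M
    | ISub d a b => mkConfig (S p) (updZ IM d (IM a - IM b)%Z) M
    | IHalf d a => mkConfig (S p) (updZ IM d (Z.div (IM a) 2)) M
    | ILoad d a => mkConfig (S p) (updZ IM d (IM (Z.to_nat (IM a)))) M
    | IStore a s => mkConfig (S p) (updZ IM (Z.to_nat (IM a)) (IM s)) M
    | IJlt a b t => mkConfig (if Z.ltb (IM a) (IM b) then t else S p) IM M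
    | RConst d z => mkConfig (S p) IM (updR M d (IZR z))
    | RofI d s => mkConfig (S p) IM (updR M d (IZR (IM s)))
    | RAdd d a b => mkConfig (S p) IM (updR M d (M a + M b))
    | RSub d a b => mkConfig (S p) IM (updR M d (M a - M b))
    | RMul d a b => mkConfig (S p) IM (updR M d (M a * M b))
    | RDiv d a b => mkConfig (S p) IM (updR M d (rdiv (M a) (M b)))
    | RLoad d a => mkConfig (S p) IM (updR M d (M (Z.to_nat (IM a))))
    | RStore a s => mkConfig (S p) IM (updR M (Z.to_nat (IM a)) (M s))
    | RJlt a b t => mkConfig (if Rlt_dec (M a) (M b) then t else S p) IM M
    | Jmp t => mkConfig t IM M
    | Halt => c
    end
  end.

Definition halted (P : program) (c : config) : Prop := step P c = None.

Fixpoint run (P : program) (k : nat) (c : config) : config :=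
  match k with
  | O => c
  | S k' => match step P c with
            | None => c
            | Some c' => run P k' c'
            end
  end.

(* Input encoding: im[0] = n; rm[0] = v; rm[1] = eps;
   rm[2+2i] = x_i, rm[3+2i] = y_i for the i-th point of S. *)
Definition init_config (S : list point) (v eps : R) : config :=
  mkConfig O
    (fun j => if Nat.eqb j 0 then Z.of_nat (length S) else 0%Z)
    (fun j => match j with
              | O => v
              | 1%nat => eps
              | S (S j') =>
                  let q := nth (Nat.div2 j') S (0, 0) in
                  if Nat.even j' then fst q else snd q
              end).

Definition output (c : config) : cross := mkCross (rm c 0) (rm c 1).

(* Main.v *)
Require Import Defs.
From Stdlib Require Import Reals List Lra Lia ZArith.
From Coquelicot Require Import Coquelicot.
Open Scope R_scope.

(* A cross is 2-approximate as soon as it minimizes the eccentricity of one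
   fixed point p0 of S, by the triangle inequality.  For a single source p0,
   translating one of the two lines so that it passes through p0 never hurts
   (the line to translate is the one nearer to p0), so that, up to exchanging
   the axes, only the abscissa a of the other line remains to be chosen.  With
   coordinates relative to p0, the time to a point (x, y) is then
   min(|y| + |x|/v, |x - a| + |a|/v + |y|/v), and its maximum over S is
   quasi-convex in a: if the maximum at a is attained at (x, y), every better
   parameter lies on the side of x.  Starting with a = 0 and then moving to the x
   of a maximizing point gives a 3-approximation together with a radius, and
   each halving of the radius costs one linear scan; ln(1/eps) + O(1) halvings
   suffice. *)

(** * Travel times *)

(* The orientation [o = true] exchanges the two coordinate axes. *)
Definition cx (o : bool) (p : point) : R := if o then snd p else fst p.
Definition line (o : bool) (H : cross) : R := if o then hy H else hx H.

(** [line (negb o)] is kept through [p0], and [a] is the offset of [line o] from [p0]. *)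
Definition branch_cross (p0 : point) (o : bool) (a : R) : cross :=
  if o then mkCross (fst p0) (snd p0 + a) else mkCross (fst p0 + a) (snd p0).

(** Two routes from [p0]: ride the line through [p0] to the abscissa of [q] and walk, or ride to the
    crossing, then along the other line to the ordinate of [q], and walk. *)
Definition branch_time (v : R) (p0 : point) (o : bool) (a : R) (q : point) : R :=
  let x := cx o q - cx o p0 in
  let y := cx (negb o) q - cx (negb o) p0 in
  Rmin (Rabs y + Rabs x / v) (Rabs (x - a) + Rabs a / v + Rabs y / v).

Lemma l1_cx (o : bool) (p q : point) :
  l1 p q = Rabs (cx o p - cx o q) + Rabs (cx (negb o) p - cx (negb o) q).
Proof. destruct o; unfold l1, cx; simpl; lra. Qed.

Lemma l1_ge0 (p q : point) : 0 <= l1 p q.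
Proof.
  unfold l1. pose proof (Rabs_pos (fst p - fst q)).
  pose proof (Rabs_pos (snd p - snd q)). lra.
Qed.

Lemma seg_time_cases (H : cross) (v : R) (p q : point) :
  seg_time H v p q = l1 p q \/
  seg_time H v p q = l1 p q / v /\
  exists o, cx o p = line o H /\ cx o q = line o H.
Proof.
  unfold seg_time.
  destruct (Req_EM_T (fst p) (hx H)), (Req_EM_T (fst q) (hx H)),
    (Req_EM_T (snd p) (hy H)), (Req_EM_T (snd q) (hy H)); auto;
    right; split; auto; try (exists false; auto; fail); exists true; auto.
Qed.

Lemma seg_time_line (H : cross) (v : R) (o : bool) (p q : point) :
  cx o p = line o H -> cx o q = line o H -> seg_time H v p q = l1 p q / v.
Proof.
  unfold seg_time; destruct o; simpl; intros Hp Hq;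
    destruct (Req_EM_T (fst p) (hx H)), (Req_EM_T (fst q) (hx H)),
      (Req_EM_T (snd p) (hy H)), (Req_EM_T (snd q) (hy H)); tauto.
Qed.

(** * Paths, their concatenation, and the infimum of their times *)

Section Speed.

Variable v : R.
Hypothesis v_gt1 : 1 < v.

Lemma inv_speed_bounds : 0 < / v < 1.
Proof.
  split; [apply Rinv_0_lt_compat; lra|].
  rewrite <- Rinv_1. apply Rinv_lt_contravar; lra.
Qed.

Lemma div_speed_le (x : R) : 0 <= x -> 0 <= x / v <= x.
Proof. intros Hx. pose proof inv_speed_bounds. unfold Rdiv. nra. Qed.

Lemma seg_time_le_l1 (H : cross) (p q : point) : 0 <= seg_time H v p q <= l1 p q.
Proof.
  pose proof (l1_ge0 p q). pose proof (div_speed_le _ H0).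
  destruct (seg_time_cases H v p q) as [E|[E _]]; rewrite E; lra.
Qed.

Lemma path_time_ge0 (H : cross) (ws : list point) :
  forall p q, 0 <= path_time H v p ws q.
Proof.
  induction ws as [|w ws IH]; intros p q; simpl.
  - apply seg_time_le_l1.
  - pose proof (seg_time_le_l1 H p w). pose proof (IH w q). lra.
Qed.

(** Upper bounds are handled through explicit waypoint lists, which concatenate; the infimum is
    taken only at the end. *)
Definition reach (H : cross) (p q : point) (t : R) : Prop :=
  exists ws, path_time H v p ws q <= t.

Lemma reach_line (H : cross) (o : bool) (p q : point) (t : R) :
  cx o p = line o H -> cx o q = line o H -> l1 p q / v <= t -> reach H p q t.
Proof.
  intros Hp Hq Ht. exists nil. simpl. rewrite (seg_time_line H v o); auto.
Qed.

Lemma reach_l1 (H : cross) (p q : point) (t : R) : l1 p q <= t -> reach H p q t.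
Proof. intros Ht. exists nil. pose proof (seg_time_le_l1 H p q). simpl. lra. Qed.

Lemma reach_trans (H : cross) (p q r : point) (s t : R) :
  reach H p q s -> reach H q r t -> reach H p r (s + t).
Proof.
  intros [ws1 H1] [ws2 H2]. exists (ws1 ++ q :: ws2).
  enough (path_time H v p (ws1 ++ q :: ws2) r =
          path_time H v p ws1 q + path_time H v q ws2 r) by lra.
  clear. revert p. induction ws1 as [|w ws IH]; intros p; simpl; [lra|].
  rewrite IH; lra.
Qed.

Lemma seg_time_sym (H : cross) (p q : point) : seg_time H v p q = seg_time H v q p.
Proof.
  assert (El : l1 p q = l1 q p).
  { unfold l1. rewrite (Rabs_minus_sym (fst p)), (Rabs_minus_sym (snd p)). lra. }
  unfold seg_time. rewrite El.
  destruct (Req_EM_T (fst p) (hx H)), (Req_EM_T (fst q) (hx H)),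
    (Req_EM_T (snd p) (hy H)), (Req_EM_T (snd q) (hy H)); auto.
Qed.

Lemma reach_sym (H : cross) (p q : point) (t : R) : reach H p q t -> reach H q p t.
Proof.
  intros [ws Hws]. revert p t Hws.
  induction ws as [|w ws IH]; simpl; intros p t Hws.
  - exists nil. simpl. rewrite seg_time_sym. exact Hws.
  - replace t with ((t - seg_time H v p w) + seg_time H v p w) by lra.
    apply reach_trans with w; [apply IH; lra|].
    exists nil. simpl. rewrite seg_time_sym. lra.
Qed.

(** Path times are nonnegative and the direct path exists, so the infimum is finite and [real] does
    not fall back on its default value. *)
Lemma travel_time_glb (H : cross) (p q : point) :
  is_glb_Rbar (fun t => exists ws, t = path_time H v p ws q) (travel_time H v p q).
Proof.
  unfold travel_time.
  set (E := fun t => exists ws, t = path_time H v p ws q).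
  pose proof (Glb_Rbar_correct E) as Hg. destruct Hg as [Hlb Hgl].
  assert (H0 : Rbar_le (Finite 0) (Glb_Rbar E)).
  { apply Hgl. intros x [ws ->]. apply path_time_ge0. }
  assert (H1 : Rbar_le (Glb_Rbar E) (Finite (path_time H v p nil q))).
  { apply Hlb. exists nil. reflexivity. }
  destruct (Glb_Rbar E) as [r| |] eqn:Er; simpl in *; try tauto.
  split; assumption.
Qed.

Lemma travel_time_le (H : cross) (p q : point) (t : R) :
  reach H p q t -> travel_time H v p q <= t.
Proof.
  intros [ws Hws]. destruct (travel_time_glb H p q) as [Hlb _].
  pose proof (Hlb _ (ex_intro _ ws eq_refl)) as Hle. simpl in Hle. lra.
Qed.

Lemma travel_time_ge (H : cross) (p q : point) (t : R) :
  (forall ws, t <= path_time H v p ws q) -> t <= travel_time H v p q.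
Proof.
  intros Ht. destruct (travel_time_glb H p q) as [_ Hgl].
  apply (Hgl (Finite t)). intros x [ws ->]. apply Ht.
Qed.

Lemma diam_le (H : cross) (A : list point) (t : R) :
  0 <= t -> (forall p q, In p A -> In q A -> travel_time H v p q <= t) ->
  diam H v A <= t.
Proof.
  intros Ht Hpq. unfold diam.
  assert (Hl : forall l, (forall pq, In pq l -> In (fst pq) A /\ In (snd pq) A) ->
    fold_right Rmax 0
      (map (fun pq => travel_time H v (fst pq) (snd pq)) l) <= t).
  { induction l as [|pq l IH]; simpl; intros Hin; [exact Ht|].
    apply Rmax_lub; [|apply IH; auto].
    destruct (Hin pq); auto. }
  apply Hl. intros [p q] Hin. apply in_prod_iff in Hin. exact Hin.
Qed.

Lemma le_diam (H : cross) (A : list point) (p q : point) :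
  In p A -> In q A -> travel_time H v p q <= diam H v A.
Proof.
  intros Hp Hq. unfold diam.
  assert (Hin : In (p, q) (list_prod A A)) by (apply in_prod; assumption).
  induction (list_prod A A) as [|pq l IH]; simpl in *; [tauto|].
  destruct Hin as [->|Hin]; [apply Rmax_l|].
  eapply Rle_trans; [apply IH, Hin|apply Rmax_r].
Qed.

Lemma reach_branch_cross (p0 q : point) (o : bool) (a : R) :
  reach (branch_cross p0 o a) p0 q (branch_time v p0 o a q).
Proof.
  unfold branch_time.
  assert (E0 : forall x : R, Rabs (x - x) = 0)
    by (intros x; rewrite Rminus_diag; apply Rabs_R0).
  set (H := branch_cross p0 o a).
  set (pt := fun x y => if o then (y, x) else (x, y) : point).
  assert (Ex : forall x y, cx o (pt x y) = x) by (intros; destruct o; reflexivity).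
  assert (Ey : forall x y, cx (negb o) (pt x y) = y)
    by (intros; destruct o; reflexivity).
  assert (Lx : line o H = cx o p0 + a) by (unfold H; destruct o; reflexivity).
  assert (Ly : line (negb o) H = cx (negb o) p0)
    by (unfold H; destruct o; reflexivity).
  apply Rmin_case.
  - rewrite Rplus_comm.
    apply reach_trans with (pt (cx o q) (cx (negb o) p0)).
    + apply reach_line with (negb o); rewrite ?Ey, ?Ly; auto.
      rewrite (l1_cx o), Ex, Ey, E0, Rplus_0_r, Rabs_minus_sym. lra.
    + apply reach_l1. rewrite (l1_cx o), Ex, Ey, E0, Rabs_minus_sym. lra.
  - rewrite Rplus_assoc, Rplus_comm.
    apply reach_trans with (pt (cx o p0 + a) (cx (negb o) q)).
    + apply reach_trans with (pt (cx o p0 + a) (cx (negb o) p0)).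
      * apply reach_line with (negb o); rewrite ?Ey, ?Ly; auto.
        rewrite (l1_cx o), Ex, Ey, E0, Rplus_0_r, Rabs_minus_sym.
        replace (cx o p0 + a - cx o p0) with a by lra. lra.
      * apply reach_line with o; rewrite ?Ex, ?Lx; auto.
        rewrite (l1_cx o), !Ex, !Ey, E0, Rplus_0_l, Rabs_minus_sym. lra.
    + apply reach_l1. rewrite (l1_cx o), Ex, Ey, E0, Rabs_minus_sym.
      replace (cx o q - (cx o p0 + a)) with (cx o q - cx o p0 - a) by lra. lra.
Qed.

(** Any two points are joined through [p0], which costs the factor 2. *)
Lemma diam_branch_cross (A : list point) (p0 : point) (o : bool) (a t : R) :
  0 <= t -> (forall q, In q A -> branch_time v p0 o a q <= t) ->
  diam (branch_cross p0 o a) v A <= 2 * t.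
Proof.
  intros Ht Hq. apply diam_le; [lra|]. intros p q Hp Hq'.
  apply Rle_trans with (branch_time v p0 o a p + branch_time v p0 o a q).
  - apply travel_time_le, reach_trans with p0; [apply reach_sym|];
      apply reach_branch_cross.
  - pose proof (Hq p Hp). pose proof (Hq q Hq'). lra.
Qed.

(* The distance from [p0 = (0, 0)] when the lines are [x = a] and [y = b] with
   [|b| <= |a|]: entering by the line [x = a] and leaving by [y = b] is then
   never needed. *)
Definition potential (a b x y : R) : R :=
  Rmin (Rmin (Rabs x + Rabs y) (Rabs b + Rabs (y - b) + Rabs x / v))
       (Rmin (Rabs a + Rabs (x - a) + Rabs y / v)
             (Rabs b + Rabs a / v + Rabs (x - a) + Rabs (y - b) / v)).

(** * Lipschitz estimates for the potential and the lower bound on travel times *)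

Lemma Rabs_diff_le (x x' c : R) : Rabs (x' - c) <= Rabs (x - c) + Rabs (x - x').
Proof.
  rewrite (Rabs_minus_sym x x').
  replace (x' - c) with ((x - c) + (x' - x)) by lra. apply Rabs_triang.
Qed.

Lemma Rabs_le_diff (x x' : R) : Rabs x' <= Rabs x + Rabs (x - x').
Proof.
  pose proof (Rabs_diff_le x x' 0) as H. rewrite !Rminus_0_r in H. exact H.
Qed.

Lemma div_speed_mono (x y : R) : x <= y -> x / v <= y / v.
Proof.
  intros Hxy. apply Rmult_le_compat_r; [apply Rlt_le, inv_speed_bounds|exact Hxy].
Qed.

Lemma Rmin_le_plus (x x' y y' t : R) :
  x' <= x + t -> y' <= y + t -> Rmin x' y' <= Rmin x y + t.
Proof.
  intros Hx Hy. unfold Rmin at 2. destruct (Rle_dec x y);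
    [pose proof (Rmin_l x' y')|pose proof (Rmin_r x' y')]; lra.
Qed.

Lemma potential_l1 (a b x y x' y' : R) :
  potential a b x' y' <= potential a b x y + (Rabs (x - x') + Rabs (y - y')).
Proof.
  pose proof (Rabs_diff_le x x' a). pose proof (Rabs_diff_le y y' b).
  pose proof (Rabs_le_diff x x'). pose proof (Rabs_le_diff y y').
  pose proof (div_speed_mono _ _ H). pose proof (div_speed_mono _ _ H0).
  pose proof (div_speed_mono _ _ H1). pose proof (div_speed_mono _ _ H2).
  pose proof (div_speed_le _ (Rabs_pos (x - x'))).
  pose proof (div_speed_le _ (Rabs_pos (y - y'))).
  unfold potential. repeat apply Rmin_le_plus; unfold Rdiv in *; lra.
Qed.

(** On the line [y = b] the potential is [|b| + |x|/v], of slope at most [1/v]. The assumption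
    [|b| <= |a|] enters in the comparison with the route that enters along [x = a]. *)
Lemma potential_horizontal (a b x x' : R) :
  Rabs b <= Rabs a -> potential a b x' b <= potential a b x b + Rabs (x - x') / v.
Proof.
  intros Hab.
  assert (E : potential a b x b = Rabs b + Rabs x / v).
  { unfold potential. rewrite Rminus_diag, Rabs_R0.
    pose proof (div_speed_le _ (Rabs_pos x)).
    pose proof (Rabs_le_diff a x) as Hx.
    rewrite Rabs_minus_sym in Hx. pose proof (div_speed_mono _ _ Hx).
    pose proof (div_speed_le _ (Rabs_pos (x - a))).
    assert (0 <= Rabs a - Rabs b) as Hab' by lra.
    pose proof (div_speed_le _ Hab').
    unfold Rdiv in *.
    rewrite (Rmin_right (Rabs x + Rabs b)) by lra.
    rewrite Rmin_left; [lra|]. apply Rmin_glb; lra. }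
  rewrite E.
  eapply Rle_trans; [apply Rmin_l|].
  eapply Rle_trans; [apply Rmin_r|].
  rewrite Rminus_diag, Rabs_R0.
  pose proof (div_speed_mono _ _ (Rabs_le_diff x x')). unfold Rdiv in *. lra.
Qed.

(** On the line [x = a] only the third and fourth routes compete, and both have slope at most [1/v]
    in [y]. *)
Lemma potential_vertical (a b y y' : R) :
  potential a b a y' <= potential a b a y + Rabs (y - y') / v.
Proof.
  assert (E : forall y, potential a b a y =
    Rmin (Rabs a + Rabs y / v) (Rabs b + Rabs a / v + Rabs (y - b) / v)).
  { clear y y'. intros y. unfold potential. rewrite Rminus_diag, Rabs_R0.
    pose proof (div_speed_le _ (Rabs_pos y)).
    pose proof (div_speed_le _ (Rabs_pos (y - b))).
    rewrite !Rplus_0_r. apply Rmin_right, Rmin_glb.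
    - eapply Rle_trans; [apply Rmin_l|]. lra.
    - eapply Rle_trans; [apply Rmin_r|]. lra. }
  rewrite !E.
  pose proof (div_speed_mono _ _ (Rabs_diff_le y y' b)).
  pose proof (div_speed_mono _ _ (Rabs_le_diff y y')).
  unfold Rdiv in *. apply Rmin_le_plus; lra.
Qed.

(* The lower bound does not depend on [b]: translating the line [y = b] to
   [y = 0], through the source, shortens every route. *)
Lemma potential_ge (a b x y : R) :
  Rmin (Rabs y + Rabs x / v) (Rabs (x - a) + Rabs a / v + Rabs y / v)
    <= potential a b x y.
Proof.
  pose proof (div_speed_le _ (Rabs_pos x)). pose proof (div_speed_le _ (Rabs_pos a)).
  pose proof (div_speed_le _ (Rabs_pos b)).
  pose proof (Rabs_le_diff b y) as Hy. rewrite Rabs_minus_sym in Hy.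
  pose proof (div_speed_mono _ _ Hy). unfold Rdiv in *.
  unfold potential. repeat apply Rmin_glb;
    (eapply Rle_trans; [apply Rmin_l|lra]) || (eapply Rle_trans; [apply Rmin_r|lra]).
Qed.

(** The potential is at most 0 at the source and grows by at most [seg_time] along each segment, so
    telescoping bounds every path from below. One pair [(o, a)] serves all targets [q], as a bound
    on the eccentricity requires. *)
Lemma travel_time_ge_branch_time (H : cross) (p0 : point) :
  exists o a, forall q, branch_time v p0 o a q <= travel_time H v p0 q.
Proof.
  (* [o] selects the line farther from [p0], which gives [|b| <= |a|]. *)
  assert (Ho : exists o, Rabs (line (negb o) H - cx (negb o) p0)
                         <= Rabs (line o H - cx o p0)).
  { destruct (Rle_dec (Rabs (line true H - cx true p0))
                      (Rabs (line false H - cx false p0)));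
      [exists false|exists true]; unfold negb; lra. }
  destruct Ho as [o Hab]. exists o, (line o H - cx o p0). intros q.
  set (a := line o H - cx o p0) in *.
  set (b := line (negb o) H - cx (negb o) p0) in *.
  set (phi := fun p => potential a b (cx o p - cx o p0) (cx (negb o) p - cx (negb o) p0)).
  assert (Hseg : forall p p', phi p' <= phi p + seg_time H v p p').
  { intros p p'. unfold phi.
    assert (Ed : forall c, cx c p - cx c p' = (cx c p - cx c p0) - (cx c p' - cx c p0))
      by (intros; lra).
    destruct (seg_time_cases H v p p') as [E|[E [o' [Hp Hp']]]];
      rewrite E, (l1_cx o), !Ed; [apply potential_l1|].
    destruct (Bool.bool_dec o' o) as [->|Hne].
    - replace (cx o p - cx o p0) with a by (unfold a; lra).
      replace (cx o p' - cx o p0) with a by (unfold a; lra).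
      rewrite (Rminus_diag a), Rabs_R0, Rplus_0_l. apply potential_vertical.
    - assert (o' = negb o) as -> by (destruct o, o'; tauto).
      replace (cx (negb o) p - cx (negb o) p0) with b by (unfold b; lra).
      replace (cx (negb o) p' - cx (negb o) p0) with b by (unfold b; lra).
      rewrite (Rminus_diag b), Rabs_R0, Rplus_0_r. apply potential_horizontal, Hab. }
  assert (Hpath : forall ws p, phi q <= phi p + path_time H v p ws q).
  { induction ws as [|w ws IH]; intros p; simpl; [apply Hseg|].
    pose proof (Hseg p w). pose proof (IH w). lra. }
  apply travel_time_ge. intros ws.
  apply Rle_trans with (phi q); [apply potential_ge|].
  pose proof (Hpath ws p0) as Hp.
  assert (E0 : phi p0 <= 0).
  { unfold phi. rewrite !Rminus_diag. unfold potential.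
    eapply Rle_trans; [apply Rmin_l|]. eapply Rle_trans; [apply Rmin_l|].
    rewrite Rabs_R0. lra. }
  lra.
Qed.

(** * Dependence of [branch_time] on the parameter [a] *)

Lemma branch_time_lipschitz (p0 q : point) (o : bool) (a a' : R) :
  branch_time v p0 o a q <= branch_time v p0 o a' q + 2 * Rabs (a' - a).
Proof.
  unfold branch_time.
  set (x := cx o q - cx o p0). set (y := cx (negb o) q - cx (negb o) p0).
  pose proof (Rabs_pos (a' - a)).
  pose proof (Rabs_diff_le a' a x) as Hx.
  rewrite (Rabs_minus_sym a x), (Rabs_minus_sym a' x) in Hx.
  pose proof (div_speed_mono _ _ (Rabs_le_diff a' a)).
  pose proof (div_speed_le _ (Rabs_pos (a' - a))).
  unfold Rdiv in *. apply Rmin_le_plus; lra.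
Qed.

(* A point [q] that limits [a] pulls every better [a'] towards its own
   abscissa, since [|x - a| + |a| / v] is monotone on either side of [x]. *)
Lemma branch_time_descent (p0 q : point) (o : bool) (a a' : R) :
  branch_time v p0 o a' q < branch_time v p0 o a q ->
  (a < cx o q - cx o p0 -> a < a') /\ (cx o q - cx o p0 <= a -> a' < a).
Proof.
  unfold branch_time.
  set (x := cx o q - cx o p0). set (y := cx (negb o) q - cx (negb o) p0).
  intros Hlt.
  (* The first term of the minimum does not depend on the parameter, so a strict decrease must come
     from the second. *)
  assert (Hg : Rabs (x - a') + Rabs a' / v < Rabs (x - a) + Rabs a / v).
  { revert Hlt. unfold Rmin. repeat destruct (Rle_dec _ _); lra. }
  pose proof (div_speed_mono _ _ (Rabs_le_diff a a')) as H1.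
  pose proof (div_speed_mono _ _ (Rabs_le_diff a' a)) as H2.
  pose proof (div_speed_le _ (Rabs_pos (a - a'))) as H3.
  pose proof (div_speed_le _ (Rabs_pos (a' - a))) as H4.
  unfold Rdiv in *.
  split; intros Hx; apply Rnot_le_lt; intros Ha;
    rewrite (Rabs_minus_sym a' a) in *.
  - rewrite (Rabs_pos_eq (x - a)), (Rabs_pos_eq (x - a')) in Hg by lra.
    rewrite (Rabs_pos_eq (a - a')) in * by lra. lra.
  - rewrite (Rabs_left1 (x - a)), (Rabs_left1 (x - a')) in Hg by lra.
    rewrite (Rabs_left1 (a - a')) in * by lra. lra.
Qed.

(** The route that avoids [line o] costs the same for [a] and [a']. It exceeds [t] at [a], so at
    [a'] the other route costs at most [t], and this route walks the distance from [a'] to the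
    abscissa of [q]. *)
Lemma branch_time_near (p0 q : point) (o : bool) (a a' t : R) :
  branch_time v p0 o a' q <= t -> t < branch_time v p0 o a q ->
  Rabs (a' - (cx o q - cx o p0)) <= t.
Proof.
  unfold branch_time. rewrite (Rabs_minus_sym a').
  set (x := cx o q - cx o p0). set (y := cx (negb o) q - cx (negb o) p0).
  pose proof (div_speed_le _ (Rabs_pos a')). pose proof (div_speed_le _ (Rabs_pos y)).
  unfold Rmin. repeat destruct (Rle_dec _ _); lra.
Qed.

End Speed.

(** * Structured programs *)

Definition state := ((nat -> Z) * (nat -> R))%type.

Definition at_pc (p : nat) (st : state) : config := mkConfig p (fst st) (snd st).

Definition is_prim (i : instr) : bool :=
  match i with IJlt _ _ _ | RJlt _ _ _ | Jmp _ | Halt => false | _ => true end.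

(** The action on memory is read off from a one-instruction program; the default [st] occurs only
    for [Halt]. *)
Definition effect (st : state) (i : instr) : state :=
  match step (i :: nil) (at_pc 0 st) with
  | Some c => (im c, rm c)
  | None => st
  end.

Inductive guard := GI (a b : nat) | GR (a b : nat).

Definition jump (g : guard) (t : nat) : instr :=
  match g with GI a b => IJlt a b t | GR a b => RJlt a b t end.

Definition holds (g : guard) (st : state) : Prop :=
  match g with
  | GI a b => (fst st a < fst st b)%Z
  | GR a b => snd st a < snd st b
  end.

Inductive cmd :=
| Block (l : list instr)
| Seq (c1 c2 : cmd)
| If (g : guard) (c : cmd)
| While (g : guard) (c : cmd).

Notation "c1 ;; c2" := (Seq c1 c2) (at level 60, right associativity).

Fixpoint len (c : cmd) : nat :=
  match c with
  | Block l => length l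
  | Seq c1 c2 => len c1 + len c2
  | If _ c => 2 + len c
  | While _ c => 3 + len c
  end.

(** Jump targets are absolute, hence the start address [p]. The machine jumps when the guard holds,
    so the body sits at [p + 2] and the instruction at [p + 1] leaves. *)
Fixpoint compile (p : nat) (c : cmd) : program :=
  match c with
  | Block l => l
  | Seq c1 c2 => compile p c1 ++ compile (p + len c1) c2
  | If g c => jump g (p + 2) :: Jmp (p + 2 + len c) :: compile (p + 2) c
  | While g c =>
      jump g (p + 2) :: Jmp (p + 3 + len c) :: compile (p + 2) c ++ Jmp p :: nil
  end.

Lemma length_compile (c : cmd) : forall p, length (compile p c) = len c.
Proof.
  induction c; intros p; simpl; rewrite ?length_app; simpl;
    rewrite ?IHc, ?IHc1, ?IHc2; lia.
Qed.

Definition code_at (P : program) (p : nat) (l : program) : Prop :=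
  forall j i, nth_error l j = Some i -> nth_error P (p + j) = Some i.

Lemma code_at_app (P : program) (p : nat) (l1 l2 : program) :
  code_at P p (l1 ++ l2) -> code_at P p l1 /\ code_at P (p + length l1) l2.
Proof.
  intros H. split; intros j i Hj.
  - apply H. rewrite nth_error_app1; auto.
    apply nth_error_Some. congruence.
  - rewrite <- Nat.add_assoc. apply H. rewrite nth_error_app2 by lia.
    rewrite <- Hj. f_equal. lia.
Qed.

Lemma code_at_cons (P : program) (p : nat) (i : instr) (l : program) :
  code_at P p (i :: l) -> nth_error P p = Some i /\ code_at P (S p) l.
Proof.
  intros H. split.
  - rewrite <- (H 0%nat i eq_refl). f_equal. lia.
  - intros j i' Hj. rewrite <- (H (S j) i' Hj). f_equal. lia.
Qed.

(** * Counted executions and rules for total correctness *)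

Inductive steps (P : program) : nat -> config -> config -> Prop :=
| steps_O c : steps P 0 c c
| steps_S k c c' c'' :
    step P c = Some c' -> steps P k c' c'' -> steps P (S k) c c''.

Lemma steps_trans (P : program) (k k' : nat) (c c' c'' : config) :
  steps P k c c' -> steps P k' c' c'' -> steps P (k + k') c c''.
Proof. induction 1; intros H'; simpl; [exact H'|econstructor; eauto]. Qed.

Lemma steps_run (P : program) (k : nat) (c c' : config) :
  steps P k c c' -> run P k c = c'.
Proof. induction 1 as [|k c c' c'' E _ IH]; simpl; [|rewrite E]; auto. Qed.

Lemma step_prim (P : program) (p : nat) (i : instr) (st : state) :
  nth_error P p = Some i -> is_prim i = true ->
  step P (at_pc p st) = Some (at_pc (S p) (effect st i)).
Proof.
  intros E Hi. unfold step, effect, at_pc. simpl. rewrite E.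
  destruct i; try discriminate; reflexivity.
Qed.

Lemma step_Jmp (P : program) (p t : nat) (st : state) :
  nth_error P p = Some (Jmp t) -> step P (at_pc p st) = Some (at_pc t st).
Proof. intros E. unfold step. simpl. rewrite E. reflexivity. Qed.

Lemma step_jump (P : program) (p t : nat) (g : guard) (st : state) :
  nth_error P p = Some (jump g t) ->
  holds g st /\ step P (at_pc p st) = Some (at_pc t st) \/
  ~ holds g st /\ step P (at_pc p st) = Some (at_pc (S p) st).
Proof.
  intros E. unfold step. simpl. rewrite E. destruct g as [a b|a b]; simpl.
  - destruct (Z.ltb_spec (fst st a) (fst st b)); [left|right]; split; auto; lia.
  - destruct (Rlt_dec (snd st a) (snd st b)); [left|right]; auto.
Qed.

(** Total correctness within [n] steps. Quantifying over the surrounding program and the address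
    makes it independent of where the fragment is placed. *)
Definition wp (c : cmd) (n : nat) (Q : state -> Prop) (st : state) : Prop :=
  forall P p, code_at P p (compile p c) ->
  exists k st', (k <= n)%nat /\
    steps P k (at_pc p st) (at_pc (p + len c) st') /\ Q st'.

Lemma wp_weaken (c : cmd) (n n' : nat) (Q Q' : state -> Prop) (st : state) :
  wp c n Q st -> (n <= n')%nat -> (forall st', Q st' -> Q' st') -> wp c n' Q' st.
Proof.
  intros H Hn HQ P p Hc. destruct (H P p Hc) as [k [st' [Hk [Hs Hq]]]].
  exists k, st'. split; [lia|auto].
Qed.

Lemma wp_block (l : list instr) (Q : state -> Prop) (st : state) :
  forallb is_prim l = true -> Q (fold_left effect l st) ->
  wp (Block l) (length l) Q st.
Proof.
  intros Hl HQ P p Hc. exists (length l), (fold_left effect l st).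
  split; [lia|]. split; [|exact HQ]. clear HQ. simpl in *.
  revert p st Hc. induction l as [|i l IH]; simpl in *; intros p st Hc.
  - rewrite Nat.add_0_r. constructor.
  - apply Bool.andb_true_iff in Hl. destruct Hl as [Hi Hl].
    apply code_at_cons in Hc. destruct Hc as [Hc1 Hc2].
    econstructor; [apply step_prim; eauto|].
    replace (p + S (length l))%nat with (S p + length l)%nat by lia. auto.
Qed.

Lemma wp_seq (c1 c2 : cmd) (n1 n2 : nat) (Q : state -> Prop) (st : state) :
  wp c1 n1 (wp c2 n2 Q) st -> wp (c1 ;; c2) (n1 + n2) Q st.
Proof.
  intros H P p Hc. simpl in Hc. apply code_at_app in Hc.
  rewrite length_compile in Hc. destruct Hc as [Hc1 Hc2].
  destruct (H P p Hc1) as [k1 [st1 [Hk1 [Hs1 H1]]]].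
  destruct (H1 P _ Hc2) as [k2 [st2 [Hk2 [Hs2 H2]]]].
  exists (k1 + k2)%nat, st2. split; [lia|]. split; [|exact H2].
  simpl. rewrite Nat.add_assoc. eapply steps_trans; eauto.
Qed.

Lemma wp_if (g : guard) (c : cmd) (n : nat) (Q : state -> Prop) (st : state) :
  (holds g st -> wp c n Q st) -> (~ holds g st -> Q st) ->
  wp (If g c) (2 + n) Q st.
Proof.
  intros Ht Hf P p Hc. simpl in Hc.
  apply code_at_cons in Hc. destruct Hc as [Hc1 Hc].
  apply code_at_cons in Hc. destruct Hc as [Hc2 Hc].
  destruct (step_jump _ _ _ _ st Hc1) as [[Hg Hs]|[Hg Hs]].
  - replace (S (S p)) with (p + 2)%nat in Hc by lia.
    destruct (Ht Hg P _ Hc) as [k [st' [Hk [Hs' HQ]]]].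
    exists (S k), st'. split; [lia|]. split; [|exact HQ].
    econstructor; [exact Hs|]. simpl.
    replace (p + S (S (len c)))%nat with (p + 2 + len c)%nat by lia. exact Hs'.
  - exists 2%nat, st. split; [lia|]. split; [|auto].
    econstructor; [exact Hs|]. econstructor; [apply step_Jmp; eauto|].
    simpl. replace (p + S (S (len c)))%nat with (p + 2 + len c)%nat by lia.
    constructor.
Qed.

(* [I k] is the invariant with at most [k] iterations to go. *)
Lemma wp_while (g : guard) (c : cmd) (n : nat) (I : nat -> state -> Prop)
    (Q : state -> Prop) (k : nat) (st : state) :
  I k st ->
  (forall j st, I j st -> holds g st ->
     exists j', j = S j' /\ wp c n (I j') st) ->
  (forall j st, I j st -> ~ holds g st -> Q st) ->
  wp (While g c) (k * (n + 2) + 2) Q st.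
Proof.
  intros HI Hb He P p Hc.
  pose proof Hc as Hc0. simpl in Hc.
  apply code_at_cons in Hc. destruct Hc as [Hc1 Hc].
  apply code_at_cons in Hc. destruct Hc as [Hc2 Hc].
  apply code_at_app in Hc. destruct Hc as [Hc3 Hc4].
  rewrite length_compile in Hc4.
  apply code_at_cons in Hc4. destruct Hc4 as [Hc4 _].
  replace (S (S p)) with (p + 2)%nat in * by lia.
  (* Induction on a bound for the remaining iterations. An iteration costs one test, the body and
     the jump back; leaving costs two steps. *)
  assert (Hm : forall m k st, (k <= m)%nat -> I k st ->
    exists i st', (i <= k * (n + 2) + 2)%nat /\
      steps P i (at_pc p st) (at_pc (p + len (While g c)) st') /\ Q st').
  { clear k st HI. induction m as [|m IH]; intros k st Hkm HI;
    (destruct (step_jump _ _ _ _ st Hc1) as [[Hg Hs]|[Hg Hs]];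
      [destruct (Hb k st HI Hg) as [k' [-> Hw]]; try lia|
       exists 2%nat, st; split; [lia|]; split; [|eauto];
       econstructor; [exact Hs|]; econstructor; [apply step_Jmp; eauto|];
       simpl; replace (p + S (S (S (len c))))%nat with (p + 3 + len c)%nat by lia;
       constructor]).
    destruct (Hw P _ Hc3) as [i1 [st1 [Hi1 [Hs1 H1]]]].
    destruct (IH k' st1) as [i2 [st2 [Hi2 [Hs2 H2]]]]; [lia|exact H1|].
    exists (S (i1 + S i2)), st2. split; [lia|]. split; [|exact H2].
    econstructor; [exact Hs|]. eapply steps_trans; [exact Hs1|].
    econstructor; [apply step_Jmp; eauto|exact Hs2]. }
  eapply Hm; eauto.
Qed.

Definition machine_of (c : cmd) : program := compile 0 c ++ Halt :: nil.

Lemma wp_machine_of (c : cmd) (n : nat) (Q : state -> Prop) (c0 : config) :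
  pc c0 = 0%nat -> wp c n Q (im c0, rm c0) ->
  exists k, (k <= n)%nat /\ halted (machine_of c) (run (machine_of c) k c0) /\
    Q (im (run (machine_of c) k c0), rm (run (machine_of c) k c0)).
Proof.
  intros H0 H. destruct (H (machine_of c) 0%nat) as [k [st [Hk [Hs HQ]]]].
  { intros j i Hj. unfold machine_of. rewrite nth_error_app1; auto.
    apply nth_error_Some. simpl. congruence. }
  assert (E : run (machine_of c) k c0 = at_pc (len c) st).
  { apply steps_run. destruct c0 as [p I M]. simpl in *. subst p. exact Hs. }
  exists k. rewrite E. split; [exact Hk|]. split; [|destruct st; exact HQ].
  unfold halted, step, machine_of. simpl.
  rewrite nth_error_app2; rewrite length_compile; [|lia].
  rewrite Nat.sub_diag. reflexivity.
Qed.

(** * The algorithm *)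

(* Real registers, from 0: the output (2 cells), v, eps, the source p0 (2 cells),
   0, the best value so far, the parameter a, the search radius s, eps * 2^j,
   the constants 12 and 2, the running maximum and the abscissa attaining it,
   and scratch cells 15-20.
   Integer registers: 2 and 3 hold the end and the beginning of the array of
   points, 4 and 5 the addresses of the two coordinates of the current point,
   1, 6, 7, 9 the values 1, 2, beginning + 1, 0, and 8 the cell saving v. *)

Definition px (o : bool) : nat := if o then 5%nat else 4%nat.

(** Real register 6 holds 0: subtracting from it negates, and adding it copies. *)
Definition rabs (d : nat) : cmd :=
  Block (RSub 17 6 d :: nil);;
  If (GR d 17) (Block (RAdd d 17 6 :: nil)).

(** [px o] names both the real register holding a coordinate of [p0] and the integer register
    holding the address of the same coordinate of the current point. *)
Definition scan_body (o : bool) : cmd :=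
  Block (RLoad 15 (px o) :: RLoad 16 (px (negb o)) ::
         RSub 15 15 (px o) :: RSub 16 16 (px (negb o)) ::
         RSub 18 15 8 :: RAdd 20 15 6 :: nil);;
  rabs 16;; rabs 18;; rabs 20;;
  Block (RDiv 17 16 2 :: RAdd 18 18 19 :: RAdd 18 18 17 ::
         RDiv 20 20 2 :: RAdd 20 16 20 :: nil);;
  If (GR 20 18) (Block (RAdd 18 20 6 :: nil));;
  If (GR 13 18) (Block (RAdd 13 18 6 :: RAdd 14 15 6 :: nil));;
  Block (IAdd 4 4 6 :: IAdd 5 5 6 :: nil).

Definition scan (o : bool) : cmd :=
  Block (IAdd 4 3 9 :: IAdd 5 7 9 :: RAdd 19 8 6 :: nil);;
  rabs 19;;
  Block (RDiv 19 19 2 :: RAdd 13 6 6 :: RAdd 14 6 6 :: nil);;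
  While (GI 4 2) (scan_body o).

Definition probe (o : bool) : cmd :=
  scan o;;
  If (GR 13 7) (Block (RAdd 7 13 6 :: RAdd 0 4 6 :: RAdd 1 5 6 ::
                       RAdd (if o then 1 else 0) (px o) 8 :: nil)).

(** The centre moves by the halved radius towards the last maximizer. Register 10 doubles, so its
    product with the radius is constant. *)
Definition refine (o : bool) : cmd :=
  Block (RDiv 9 9 12 :: RSub 15 8 9 :: nil);;
  If (GR 8 14) (Block (RAdd 15 8 9 :: nil));;
  Block (RAdd 8 15 6 :: RAdd 10 10 10 :: nil);;
  probe o.

(** The maximizer at [a = 0] gives the centre, and the maximum observed at that centre is the first
    radius. *)
Definition search (o : bool) : cmd :=
  Block (RAdd 8 6 6 :: nil);;
  probe o;;
  Block (RAdd 8 14 6 :: nil);;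
  probe o;;
  Block (RAdd 9 13 6 :: RAdd 10 3 6 :: nil);;
  While (GR 10 11) (refine o).

(* The input occupies the low registers, so it is first copied upwards. *)
Definition setup : cmd :=
  Block (IConst 1 1 :: IConst 6 2 :: IConst 9 0 :: IAdd 2 0 0 :: IConst 3 40 ::
         IAdd 3 2 3 :: IAdd 2 2 3 :: IConst 4 2 :: IAdd 5 3 9 ::
         ISub 8 3 1 :: RStore 8 0 :: nil);;
  While (GI 5 2)
    (Block (RLoad 0 4 :: RStore 5 0 :: IAdd 4 4 1 :: IAdd 5 5 1 :: nil));;
  Block (RLoad 2 8 :: RConst 6 0 :: RAdd 3 1 6 :: RLoad 4 3 :: IAdd 7 3 1 ::
         RLoad 5 7 :: RConst 11 12 :: RConst 12 2 ::
         RAdd 0 4 6 :: RAdd 1 5 6 :: RConst 8 0 :: nil).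

(** The scan at [a = 0] evaluates the cross centred at [p0], so a valid best value exists before the
    two searches. *)
Definition highway_cmd : cmd :=
  setup;; scan false;; Block (RAdd 7 13 6 :: nil);; search false;; search true.

Ltac run_block := apply wp_block; [reflexivity|];
  cbn [fold_left effect step at_pc nth_error im rm pc fst snd px negb].

Lemma wp_rabs (d : nat) (I : nat -> Z) (M : nat -> R) (Q : state -> Prop) :
  M 6%nat = 0 -> d <> 6%nat -> d <> 17%nat ->
  (forall M', M' d = Rabs (M d) ->
     (forall r, r <> d -> r <> 17%nat -> M' r = M r) -> Q (I, M')) ->
  wp (rabs d) 4 Q (I, M).
Proof.
  intros Z6 D6 D17 H. apply (wp_seq _ _ 1 3). run_block.
  apply (wp_if _ _ 1); intros Hg; cbn [holds snd] in Hg; unfold updR in Hg; simpl in Hg;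
    apply Nat.eqb_neq in D17 as E17; rewrite E17 in Hg.
  - run_block. apply H.
    + unfold updR. rewrite Nat.eqb_refl. simpl.
      rewrite Rabs_left by lra. lra.
    + intros r Hd H17. unfold updR. apply Nat.eqb_neq in Hd, H17.
      rewrite Hd, H17. reflexivity.
  - apply H.
    + unfold updR. rewrite E17, Rabs_pos_eq; lra.
    + intros r _ H17. unfold updR. apply Nat.eqb_neq in H17.
      rewrite H17. reflexivity.
Qed.

Ltac cbn_effect := cbn [fold_left effect step at_pc nth_error im rm pc fst snd].

Lemma updR_neq (f : nat -> R) (i j : nat) (x : R) : j <> i -> updR f i x j = f j.
Proof. intros H. unfold updR. apply Nat.eqb_neq in H. rewrite H. reflexivity. Qed.

(** The new real memory becomes a variable known only by its values, which keeps nested updates out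
    of the goals. *)
Lemma wp_block_frame (l : list instr) (I I' : nat -> Z) (M : nat -> R)
    (Q : state -> Prop) :
  forallb is_prim l = true -> fst (fold_left effect l (I, M)) = I' ->
  (forall M', (forall r, M' r = snd (fold_left effect l (I, M)) r) -> Q (I', M')) ->
  wp (Block l) (length l) Q (I, M).
Proof.
  intros Hl <- HQ. apply wp_block; [exact Hl|].
  specialize (HQ _ (fun r => eq_refl)). destruct (fold_left effect l (I, M)). exact HQ.
Qed.

(** * Correctness and cost of the pieces of the program *)

Section Algorithm.

Variables (A : list point) (v eps : R).
Hypothesis v_gt1 : 1 < v.
Hypothesis eps_gt0 : 0 < eps.
Hypothesis A_nonempty : (1 <= length A)%nat.

Let n := length A.
Let base := (40 + 2 * n)%nat.
Let pt (i : nat) := nth i A (0, 0).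
Let p0 := pt 0.
Let time := branch_time v p0.

Record env (st : state) : Prop := mkEnv {
  env_end : fst st 2%nat = Z.of_nat (base + 2 * n);
  env_base : fst st 3%nat = Z.of_nat base;
  env_two : fst st 6%nat = 2%Z;
  env_snd : fst st 7%nat = Z.of_nat (base + 1);
  env_zero : fst st 9%nat = 0%Z;
  env_v : snd st 2%nat = v;
  env_eps : snd st 3%nat = eps;
  env_src : forall o, snd st (px o) = cx o p0;
  env_rzero : snd st 6%nat = 0;
  env_12 : snd st 11%nat = 12;
  env_rtwo : snd st 12%nat = 2;
  env_pts : forall (o : bool) i, (i < n)%nat ->
    snd st (base + 2 * i + if o then 1 else 0)%nat = cx o (pt i)
}.

(** Real registers on which [env] makes no demand: output, search data and scratch. *)
Definition volatile (r : nat) : bool :=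
  (r <=? 1)%nat || (7 <=? r)%nat && (r <=? 10)%nat || (13 <=? r)%nat && (r <=? 20)%nat.

Lemma env_frame (st st' : state) :
  env st -> (forall r, r <> 4%nat -> r <> 5%nat -> fst st' r = fst st r) ->
  (forall r, volatile r = false -> snd st' r = snd st r) -> env st'.
Proof.
  intros H HI HM. destruct H. constructor; rewrite ?HI by lia; auto;
    try (rewrite HM by reflexivity; auto).
  - intros o. rewrite HM; [auto|destruct o; reflexivity].
  - intros o i Hi. rewrite HM; [auto|].
    set (r := (base + 2 * i + _)%nat). assert (40 <= r)%nat by (unfold r, base; lia).
    unfold volatile. destruct (Nat.leb_spec r 1), (Nat.leb_spec r 10),
      (Nat.leb_spec r 20); lia.
Qed.

Lemma pt_In (i : nat) : (i < n)%nat -> In (pt i) A.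
Proof. apply nth_In. Qed.

Lemma In_pt (q : point) : In q A -> exists i, (i < n)%nat /\ pt i = q.
Proof. intros Hq. destruct (In_nth A q (0, 0) Hq) as [i [Hi E]]. exists i; auto. Qed.

Lemma rdiv_speed (x y : R) : y = v -> rdiv x y = x / v.
Proof. intros ->. unfold rdiv. destruct (Req_EM_T v 0); [lra|reflexivity]. Qed.

(** The final disjunction keeps registers 13 and 14 tied to one and the same point, so that a scan
    can exhibit a maximizer. *)
Lemma wp_scan_body (o : bool) (a : R) (i : nat) (I : nat -> Z) (M : nat -> R)
    (Q : state -> Prop) :
  env (I, M) -> (i < n)%nat ->
  I 4%nat = Z.of_nat (base + 2 * i) -> I 5%nat = Z.of_nat (base + 2 * i + 1) ->
  M 8%nat = a -> M 19%nat = Rabs a / v ->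
  (forall I' M',
     (forall r, r <> 4%nat -> r <> 5%nat -> I' r = I r) ->
     (forall r, (r < 13 \/ 20 < r)%nat -> M' r = M r) -> M' 19%nat = M 19%nat ->
     I' 4%nat = Z.of_nat (base + 2 * S i) ->
     I' 5%nat = Z.of_nat (base + 2 * S i + 1) ->
     M 13%nat <= M' 13%nat -> time o a (pt i) <= M' 13%nat ->
     M' 13%nat = M 13%nat /\ M' 14%nat = M 14%nat \/
     M' 13%nat = time o a (pt i) /\ M' 14%nat = cx o (pt i) - cx o p0 ->
     Q (I', M')) ->
  wp (scan_body o) 32 Q (I, M).
Proof.
  intros E Hi I4 I5 M8 M19 HQ.
  assert (HI : forall I',
    I' = updZ (updZ I 4 (I 4%nat + I 6%nat)%Z) 5 (I 5%nat + I 6%nat)%Z ->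
    (forall r, r <> 4%nat -> r <> 5%nat -> I' r = I r) /\
     I' 4%nat = Z.of_nat (base + 2 * S i) /\
     I' 5%nat = Z.of_nat (base + 2 * S i + 1)).
  { intros I' ->. destruct E; cbn [fst snd] in *. unfold updZ.
    split; [|split].
    - intros r H4 H5. apply Nat.eqb_neq in H4, H5. rewrite H4, H5. reflexivity.
    - cbn [Nat.eqb]. lia.
    - cbn [Nat.eqb]. lia. }
  set (x := cx o (pt i) - cx o p0).
  set (y := cx (negb o) (pt i) - cx (negb o) p0).
  destruct E as [_ _ _ _ _ Ev _ Es Ez _ _ Ep]; cbn [fst snd] in *.
  assert (Hlow : forall r, (r < 13 \/ 20 < r)%nat ->
    r <> 13%nat /\ r <> 14%nat /\ r <> 15%nat /\ r <> 16%nat /\ r <> 17%nat /\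
    r <> 18%nat /\ r <> 20%nat) by lia.
  assert (Ip : forall o : bool,
    Z.to_nat (I (px o)) = (base + 2 * i + if o then 1 else 0)%nat).
  { intros []; cbn [px]; rewrite ?I4, ?I5, Nat2Z.id; lia. }
  apply (wp_seq _ _ 6 26), wp_block_frame with (I' := I); [reflexivity|reflexivity|].
  cbn_effect. rewrite !Ip. intros M1 H1.
  assert (X1 : M1 15%nat = x /\ M1 16%nat = y /\ M1 18%nat = x - a /\
               M1 20%nat = x).
  { rewrite !H1. unfold x, y. rewrite <- !Es, <- !Ep by assumption.
    destruct o; cbn [px negb]; unfold updR, base; simpl; lra. }
  destruct X1 as [X15 [X16 [X18 X20]]].
  assert (F1 : forall r, (r < 15 \/ 20 < r \/ r = 19)%nat -> M1 r = M r).
  { intros r Hr. rewrite H1.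
    repeat (rewrite updR_neq by lia). reflexivity. }
  clear H1.
  apply (wp_seq _ _ 4 22), wp_rabs; [rewrite F1; auto; lia|lia|lia|].
  intros M2 Y2 F2. rewrite X16 in Y2.
  apply (wp_seq _ _ 4 18), wp_rabs; [rewrite F2, F1; auto; lia|lia|lia|].
  intros M3 Y3 F3. rewrite F2, X18 in Y3 by lia.
  apply (wp_seq _ _ 4 14), wp_rabs; [rewrite F3, F2, F1; auto; lia|lia|lia|].
  intros M4 Y4 F4. rewrite F3, F2, X20 in Y4 by lia.
  apply (wp_seq _ _ 5 9), wp_block_frame with (I' := I); [reflexivity|reflexivity|].
  cbn_effect. intros M5 H5.
  assert (X5 : M5 18%nat = Rabs (x - a) + Rabs a / v + Rabs y / v /\
               M5 20%nat = Rabs y + Rabs x / v).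
  { rewrite !H5. unfold updR; simpl.
    rewrite !rdiv_speed by (rewrite F4, F3, F2, F1 by lia; exact Ev).
    rewrite Y4, F4, Y3, !F4, !F3, !Y2, F2, F1, M19 by lia. lra. }
  destruct X5 as [X18' X20'].
  assert (F5 : forall r, (r < 16 \/ 20 < r \/ r = 19)%nat -> M5 r = M1 r).
  { intros r Hr. rewrite H5.
    repeat (rewrite updR_neq by lia).
    rewrite F4, F3, F2; lia || reflexivity. }
  clear H5 F2 F3 F4 M2 M3 M4 Y2 Y3 Y4.
  (* Common tail of both branches of the minimum, once register 18 holds the time of the current
     point. *)
  assert (Hend : forall M6,
    M6 18%nat = time o a (pt i) ->
    (forall r, (r < 16 \/ 20 < r \/ r = 19)%nat -> M6 r = M5 r) ->
    wp (If (GR 13 18) (Block (RAdd 13 18 6 :: RAdd 14 15 6 :: nil));;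
        Block (IAdd 4 4 6 :: IAdd 5 5 6 :: nil)) 6 Q (I, M6)).
  { intros M6 X6 F6.
    assert (F : forall r, (r < 15 \/ 20 < r \/ r = 19)%nat -> M6 r = M r).
    { intros r Hr. rewrite F6, F5, F1; lia || reflexivity. }
    assert (X6' : M6 15%nat = x) by (rewrite F6, F5; lia || exact X15).
    apply (wp_seq _ _ 4 2), (wp_if _ _ 2); cbn [holds snd]; intros Hg.
    - apply wp_block_frame with (I' := I); [reflexivity|reflexivity|].
      cbn_effect. intros M7 H7.
      eapply wp_block_frame; [reflexivity|reflexivity|]. cbn_effect.
      intros M8' H8. destruct (HI _ eq_refl) as [HI1 [HI2 HI3]].
      assert (G : forall r, r <> 13%nat -> r <> 14%nat -> M8' r = M6 r).
      { intros r N13 N14. rewrite H8, H7.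
        rewrite !updR_neq by assumption. reflexivity. }
      assert (Z6 : M6 6%nat = 0) by (rewrite F; auto; lia).
      assert (G13 : M8' 13%nat = time o a (pt i))
        by (rewrite H8, H7; unfold updR; simpl; lra).
      assert (G14 : M8' 14%nat = x)
        by (rewrite H8, H7; unfold updR; simpl; lra).
      rewrite F in Hg by lia.
      apply HQ; auto; try lra.
      + intros r Hr. rewrite G, F; lia || reflexivity.
      + rewrite G, F; lia || reflexivity.
    - eapply wp_block_frame; [reflexivity|reflexivity|]. cbn_effect.
      intros M8' H8. destruct (HI _ eq_refl) as [HI1 [HI2 HI3]].
      rewrite <- (H8 13%nat), <- (H8 18%nat) in Hg.
      rewrite (H8 18%nat), X6 in Hg.
      apply HQ; auto; try lra.
      + intros r Hr. rewrite H8, F; lia || reflexivity.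
      + rewrite H8, F; lia || reflexivity.
      + rewrite H8, F; lia || lra.
      + left. rewrite !H8, !F; auto; lia. }
  apply (wp_seq _ _ 3 6), (wp_if _ _ 1); cbn [holds snd]; intros Hg;
    rewrite X18', X20' in Hg.
  - apply wp_block_frame with (I' := I); [reflexivity|reflexivity|].
    cbn_effect. intros M6 H6. apply Hend.
    + rewrite H6. unfold updR; simpl. rewrite X20', F5, F1, Ez by lia.
      unfold time, branch_time. fold x y. rewrite Rmin_left; lra.
    + intros r Hr. rewrite H6. apply updR_neq. lia.
  - apply Hend; auto. rewrite X18'. unfold time, branch_time. fold x y.
    rewrite Rmin_right; lra.
Qed.

Lemma time_source (o : bool) (a : R) : time o a p0 = 0.
Proof.
  unfold time, branch_time. rewrite !Rminus_diag, Rabs_R0.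
  pose proof (div_speed_le v v_gt1 _ (Rabs_pos a)).
  pose proof (Rabs_pos (0 - a)).
  rewrite Rmin_left; unfold Rdiv in *; lra.
Qed.

Definition argmax (o : bool) (a : R) (M : nat -> R) : Prop :=
  (forall q, In q A -> time o a q <= M 13%nat) /\
  exists q, In q A /\ M 13%nat = time o a q /\ M 14%nat = cx o q - cx o p0.

Lemma wp_scan (o : bool) (a : R) (I : nat -> Z) (M : nat -> R) (Q : state -> Prop) :
  env (I, M) -> M 8%nat = a ->
  (forall I' M', env (I', M') ->
     (forall r, (r < 13 \/ 20 < r)%nat -> M' r = M r) -> argmax o a M' -> Q (I', M')) ->
  wp (scan o) (34 * n + 12) Q (I, M).
Proof.
  intros E M8 HQ.
  pose proof E as [E2 E3 E6 E7 E9 Ev _ _ Ez _ _ _]; cbn [fst snd] in *.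
  apply wp_weaken with (Q := Q) (n := (3 + (4 + (3 + (n * (32 + 2) + 2))))%nat);
    [|lia|auto].
  eapply (wp_seq _ _ 3), wp_block_frame; [reflexivity|reflexivity|]. cbn_effect.
  intros M1 H1.
  set (I1 := updZ _ _ _).
  assert (HI1 : forall r, r <> 4%nat -> r <> 5%nat -> I1 r = I r).
  { intros r H4 H5. apply Nat.eqb_neq in H4, H5. unfold I1, updZ.
    rewrite H4, H5. reflexivity. }
  assert (HI4 : I1 4%nat = Z.of_nat base)
    by (unfold I1, updZ; cbn [Nat.eqb]; lia).
  assert (HI5 : I1 5%nat = Z.of_nat (base + 1))
    by (unfold I1, updZ; cbn [Nat.eqb]; lia).
  assert (X1 : M1 19%nat = a) by (rewrite H1; unfold updR; simpl; lra).
  assert (F1 : forall r, r <> 19%nat -> M1 r = M r)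
    by (intros r Hr; rewrite H1; apply updR_neq, Hr).
  apply (wp_seq _ _ 4), wp_rabs; [rewrite F1; auto; lia|lia|lia|].
  intros M2 X2 F2. rewrite X1 in X2.
  apply (wp_seq _ _ 3), wp_block_frame with (I' := I1); [reflexivity|reflexivity|].
  cbn_effect. intros M3 H3.
  assert (X3 : M3 13%nat = 0 /\ M3 14%nat = 0 /\ M3 19%nat = Rabs a / v).
  { rewrite !H3. unfold updR; simpl.
    rewrite rdiv_speed by (rewrite F2, F1 by lia; exact Ev).
    rewrite X2, F2, F1, Ez by lia. lra. }
  destruct X3 as [X13 [X14 X19]].
  assert (F3 : forall r, (r < 13 \/ 20 < r)%nat -> M3 r = M r).
  { intros r Hr. rewrite H3. repeat (rewrite updR_neq by lia).
    rewrite F2, F1; lia || reflexivity. }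
  assert (Hframe : forall r, volatile r = false -> (r < 13 \/ 20 < r)%nat).
  { unfold volatile. intros r Hr.
    destruct (Nat.leb_spec 13 r), (Nat.leb_spec r 20); lia. }
  clear H1 H3 F1 F2 X1 X2 M1 M2.
  apply wp_while with (I := fun k st => exists i, (i + k = n)%nat /\ env st /\
    (forall r, (r < 13 \/ 20 < r)%nat -> snd st r = M r) /\
    snd st 19%nat = Rabs a / v /\
    fst st 4%nat = Z.of_nat (base + 2 * i) /\
    fst st 5%nat = Z.of_nat (base + 2 * i + 1) /\
    (forall j, (j < i)%nat -> time o a (pt j) <= snd st 13%nat) /\
    exists q, In q A /\ snd st 13%nat = time o a q /\
              snd st 14%nat = cx o q - cx o p0).
  - exists 0%nat; cbn [fst snd]. split; [lia|]. split; [|split; [|split; [|split;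
      [|split; [|split]]]]]; auto.
    + eapply env_frame; [exact E|exact HI1|].
      intros r Hr. apply F3. auto.
    + rewrite HI4. f_equal; lia.
    + rewrite HI5. f_equal; lia.
    + intros j Hj; lia.
    (* The initial maximum 0 with abscissa 0 is the one attained at [p0] itself. *)
    + exists p0. split; [apply pt_In; unfold n; lia|].
      rewrite time_source. split; lra.
  - intros k [I' M'] [i [Hik [E' [F' [Y19 [Y4 [Y5 [Hmax [q [Hq [Y13 Y14]]]]]]]]]]] Hg.
    cbn [holds fst snd] in *.
    pose proof (env_end _ E') as Eend. cbn [fst] in Eend. rewrite Y4, Eend in Hg.
    destruct k as [|k]; [lia|]. exists k. split; [reflexivity|].
    apply wp_scan_body with (a := a) (i := i); auto; [lia|rewrite F'; auto; lia|].
    intros I'' M'' GI GM G19 G4 G5 Hle Ht Hcase. exists (S i); cbn [fst snd].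
    split; [lia|]. split; [|split; [|split; [|split; [|split; [|split]]]]]; auto.
    + eapply env_frame; [exact E'|exact GI|]. intros r Hr. apply GM. auto.
    + intros r Hr. rewrite GM; auto.
    + rewrite G19. exact Y19.
    + intros j Hj. destruct (Nat.eq_dec j i) as [->|Hne]; [exact Ht|].
      eapply Rle_trans; [apply Hmax; lia|exact Hle].
    + destruct Hcase as [[C1 C2]|[C1 C2]]; rewrite C1, C2.
      * exists q. auto.
      * exists (pt i). split; [apply pt_In; lia|auto].
  - intros k [I' M'] [i [Hik [E' [F' [Y19 [Y4 [Y5 [Hmax Hq]]]]]]]] Hg.
    cbn [holds fst snd] in *.
    pose proof (env_end _ E') as Eend. cbn [fst] in Eend. rewrite Y4, Eend in Hg.
    apply HQ; auto. split; [|exact Hq].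
    intros q' Hq'. destruct (In_pt q' Hq') as [j [Hj <-]]. apply Hmax. lia.
Qed.

(** Kept throughout the search: the best value is always certified by the cross in the output
    registers. *)
Definition sound (M : nat -> R) : Prop :=
  exists o a, mkCross (M 0%nat) (M 1%nat) = branch_cross p0 o a /\
    forall q, In q A -> time o a q <= M 7%nat.

Lemma wp_probe (o : bool) (a : R) (I : nat -> Z) (M : nat -> R) (Q : state -> Prop) :
  env (I, M) -> M 8%nat = a -> sound M ->
  (forall I' M', env (I', M') ->
     (forall r, (8 <= r <= 10)%nat -> M' r = M r) -> argmax o a M' -> sound M' ->
     M' 7%nat <= M 7%nat -> M' 7%nat <= M' 13%nat -> Q (I', M')) ->
  wp (probe o) (34 * n + 18) Q (I, M).
Proof.
  intros E M8 Hs HQ.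
  apply wp_weaken with (Q := Q) (n := ((34 * n + 12) + (2 + 4))%nat); [|lia|auto].
  apply wp_seq, wp_scan with (a := a); auto. intros I1 M1 E1 F1 Hmax.
  apply (wp_if _ _ 4); cbn [holds snd]; intros Hg.
  - apply wp_block_frame with (I' := I1); [destruct o; reflexivity|reflexivity|].
    cbn_effect. intros M2 H2.
    pose proof (env_rzero _ E1) as Ez. pose proof (env_src _ E1) as Es.
    cbn [snd] in Ez, Es. pose proof (Es false) as Ex. pose proof (Es true) as Ey.
    simpl in Ex, Ey.
    assert (X7 : M2 7%nat = M1 13%nat)
      by (rewrite H2; destruct o; unfold updR; simpl; lra).
    assert (F2 : forall r, (r <> 0 -> r <> 1 -> r <> 7 -> M2 r = M1 r)%nat).
    { intros r N0 N1 N7. rewrite H2.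
      rewrite !updR_neq by (destruct o; assumption). reflexivity. }
    assert (Hmax2 : argmax o a M2) by (unfold argmax; rewrite !F2 by lia; exact Hmax).
    apply HQ; auto.
    + eapply env_frame; [exact E1|auto|]. intros r Hr. apply F2;
        intros ->; discriminate Hr.
    + intros r Hr. rewrite F2, F1; lia || reflexivity.
    + exists o, a. split.
      * rewrite !H2. unfold branch_cross, updR; destruct o; simpl in *;
          rewrite ?Ex, ?Ey, ?Ez, ?Rplus_0_r, ?(F1 8%nat), ?M8 by lia; reflexivity.
      * rewrite X7. apply Hmax.
    + rewrite X7, <- (F1 7%nat) by lia. lra.
    + rewrite X7, F2 by lia. lra.
  - apply HQ; auto.
    + intros r Hr. apply F1. lia.
    + unfold sound. rewrite !F1 by lia. exact Hs.
    + rewrite F1 by lia. lra.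
    + lra.
Qed.

Definition ecc_le (o : bool) (a t : R) : Prop := forall q, In q A -> time o a q <= t.

Lemma ecc_le_ge0 (o : bool) (a t : R) : ecc_le o a t -> 0 <= t.
Proof.
  intros H. rewrite <- (time_source o a). apply H, pt_In. unfold n. lia.
Qed.

(** [best] is the value on entry, so the second search cannot lose what the first achieved; [k]
    bounds the halvings left. In [inv_near], unless the best value is already at most [t], a
    parameter of eccentricity at most [t] lies within the radius, and the radius is at most
    [3 t / 2^j] because register 10 holds [eps * 2^j]. *)
Record search_inv (o : bool) (best : R) (k : nat) (st : state) : Prop := mkInv {
  inv_env : env st;
  inv_sound : sound (snd st);
  inv_best : snd st 7%nat <= best;
  inv_max : argmax o (snd st 8%nat) (snd st);
  inv_max_best : snd st 7%nat <= snd st 13%nat;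
  inv_gt0 : 0 < snd st 10%nat;
  inv_steps : 12 <= 2 ^ k * snd st 10%nat;
  inv_near : forall a' t, ecc_le o a' t -> snd st 7%nat <= t \/
    Rabs (a' - snd st 8%nat) <= snd st 9%nat /\
    snd st 9%nat * snd st 10%nat <= 3 * t * eps
}.

(** Knowing the side leaves an interval of length [s], whose midpoint is within [s / 2] of [a']. *)
Lemma descent_step (a a' s x : R) :
  Rabs (a' - a) <= s -> (a < x -> a < a') -> (x <= a -> a' < a) ->
  Rabs (a' - (if Rlt_dec a x then a + s / 2 else a - s / 2)) <= s / 2.
Proof.
  intros Hs Hl Hr. apply Rabs_le_between in Hs. apply Rabs_le_between.
  destruct (Rlt_dec a x); [specialize (Hl r)|specialize (Hr ltac:(lra))]; lra.
Qed.

Lemma wp_refine (o : bool) (best : R) (k : nat) (st : state) :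
  search_inv o best (S k) st -> wp (refine o) (34 * n + 25) (search_inv o best k) st.
Proof.
  intros [E Hs Hb [Hmax [q [Hq [X13 X14]]]] Hmb H0 Hk Hn].
  destruct st as [I M]; cbn [fst snd] in *.
  pose proof (env_rzero _ E) as Ez. pose proof (env_rtwo _ E) as Et.
  cbn [snd] in Ez, Et.
  assert (Hdiv : rdiv (M 9%nat) (M 12%nat) = M 9%nat / 2).
  { rewrite Et. unfold rdiv. destruct (Req_EM_T 2 0); lra. }
  set (a1 := if Rlt_dec (M 8%nat) (M 14%nat) then M 8%nat + M 9%nat / 2
             else M 8%nat - M 9%nat / 2).
  eapply wp_weaken with (n := (2 + ((2 + 1) + (2 + (34 * n + 18))))%nat);
    [|lia|intros st' Hst'; exact Hst'].
  apply (wp_seq _ _ 2), wp_block_frame with (I' := I); [reflexivity|reflexivity|].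
  cbn_effect. intros M1 H1.
  assert (F1 : forall r, r <> 9%nat -> r <> 15%nat -> M1 r = M r).
  { intros r N9 N15. rewrite H1, !updR_neq by assumption. reflexivity. }
  assert (X1 : M1 9%nat = M 9%nat / 2 /\ M1 15%nat = M 8%nat - M 9%nat / 2).
  { rewrite !H1. unfold updR; simpl. rewrite Hdiv. lra. }
  destruct X1 as [X9 X15].
  assert (Hend : forall M2, M2 15%nat = a1 ->
    (forall r, r <> 15%nat -> M2 r = M1 r) ->
    wp (Block (RAdd 8 15 6 :: RAdd 10 10 10 :: nil);; probe o)
       (2 + (34 * n + 18)) (search_inv o best k) (I, M2)).
  { intros M2 X2 F2.
    apply (wp_seq _ _ 2), wp_block_frame with (I' := I); [reflexivity|reflexivity|].
    cbn_effect. intros M3 H3.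
    assert (F3 : forall r, (r <> 8 -> r <> 9 -> r <> 10 -> r <> 15 -> M3 r = M r)%nat).
    { intros r N8 N9 N10 N15. rewrite H3, !updR_neq, F2, F1 by assumption.
      reflexivity. }
    assert (Y8 : M3 8%nat = a1).
    { rewrite H3. unfold updR; simpl. rewrite X2, F2, F1 by lia. lra. }
    assert (Y9 : M3 9%nat = M 9%nat / 2).
    { rewrite H3. unfold updR; simpl. rewrite F2 by lia. exact X9. }
    assert (Y10 : M3 10%nat = 2 * M 10%nat).
    { rewrite H3. unfold updR; simpl. rewrite F2, F1 by lia. lra. }
    apply wp_probe with (a := a1); auto.
    - eapply env_frame; [exact E|auto|]. intros r Hr.
      apply F3; intros ->; discriminate Hr.
    - unfold sound. rewrite !F3 by lia. exact Hs.
    - intros I4 M4 E4 F4 Hmax4 Hs4 Hb4 Hmb4. rewrite F3 in Hb4 by lia.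
      assert (Z8 : M4 8%nat = a1) by (rewrite F4; auto; lia).
      assert (Z9 : M4 9%nat = M 9%nat / 2) by (rewrite F4; auto; lia).
      assert (Z10 : M4 10%nat = 2 * M 10%nat) by (rewrite F4; auto; lia).
      constructor; cbn [fst snd]; rewrite ?Z8, ?Z9, ?Z10; auto; try lra.
      + simpl in Hk. lra.
      + intros a' t Ht. destruct (Hn a' t Ht) as [Hle|[Hnear Hs3]]; [left; lra|].
        (* Otherwise [t] is below the maximum at the current centre, so [a'] is strictly better at
           the maximizer [q], and [branch_time_descent] gives its side. *)
        destruct (Rle_dec (M 7%nat) t) as [Hle|Hgt]; [left; lra|right].
        split; [|lra]. unfold a1. rewrite X14.
        destruct (branch_time_descent v v_gt1 p0 q o (M 8%nat) a') as [Hl Hr].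
        { fold (time o a' q) (time o (M 8%nat) q). rewrite <- X13.
          apply Rle_lt_trans with t; [apply Ht, Hq|lra]. }
        apply descent_step; auto. }
  apply wp_seq, (wp_if _ _ 1); cbn [holds snd]; intros Hg; rewrite !F1 in Hg by lia.
  - apply wp_block_frame with (I' := I); [reflexivity|reflexivity|].
    cbn_effect. intros M2 H2. apply Hend.
    + rewrite H2. unfold updR; simpl. rewrite X9, F1 by lia.
      unfold a1. destruct (Rlt_dec _ _); [reflexivity|lra].
    + intros r Hr. rewrite H2. apply updR_neq, Hr.
  - apply Hend; auto. rewrite X15. unfold a1.
    destruct (Rlt_dec _ _); [lra|reflexivity].
Qed.

Lemma wp_search (o : bool) (N : nat) (I : nat -> Z) (M : nat -> R) (Q : state -> Prop) :
  env (I, M) -> sound M -> 12 <= 2 ^ N * eps ->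
  (forall I' M', env (I', M') -> sound M' -> M' 7%nat <= M 7%nat ->
     (forall a' t, ecc_le o a' t -> M' 7%nat <= (1 + eps / 2) * t) -> Q (I', M')) ->
  wp (search o) (68 * n + 42 + N * (34 * n + 27)) Q (I, M).
Proof.
  intros E Hs HN HQ.
  apply wp_weaken with (Q := Q) (n := (1 + ((34 * n + 18) + (1 + ((34 * n + 18) +
    (2 + (N * ((34 * n + 25) + 2) + 2))))))%nat); [|lia|auto].
  pose proof (env_rzero _ E) as Ez. cbn [snd] in Ez.
  apply (wp_seq _ _ 1), wp_block_frame with (I' := I); [reflexivity|reflexivity|].
  cbn_effect. intros M1 H1.
  assert (F1 : forall r, r <> 8%nat -> M1 r = M r)
    by (intros r Hr; rewrite H1; apply updR_neq, Hr).
  apply wp_seq, wp_probe with (a := 0).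
  - eapply env_frame; [exact E|auto|].
    intros r Hr. apply F1. intros ->; discriminate Hr.
  - rewrite H1. unfold updR; simpl. lra.
  - unfold sound. rewrite !F1 by lia. exact Hs.
  - intros I2 M2 E2 F2 [_ [q0 [Hq0 [X13 X14]]]] Hs2 Hb2 Hmb2.
    rewrite F1 in Hb2 by lia.
    pose proof (env_rzero _ E2) as Ez2. cbn [snd] in Ez2.
    apply (wp_seq _ _ 1), wp_block_frame with (I' := I2); [reflexivity|reflexivity|].
    cbn_effect. intros M3 H3.
    assert (F3 : forall r, r <> 8%nat -> M3 r = M2 r)
      by (intros r Hr; rewrite H3; apply updR_neq, Hr).
    set (x0 := cx o q0 - cx o p0) in *.
    apply wp_seq, wp_probe with (a := x0).
    + eapply env_frame; [exact E2|auto|].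
      intros r Hr. apply F3. intros ->; discriminate Hr.
    + rewrite H3. unfold updR; simpl. lra.
    + unfold sound. rewrite !F3 by lia. exact Hs2.
    + intros I4 M4 E4 F4 Hmax4 Hs4 Hb4 Hmb4. rewrite F3 in Hb4 by lia.
      assert (X8 : M4 8%nat = x0)
        by (rewrite F4, H3 by lia; unfold updR; simpl; lra).
      pose proof (env_rzero _ E4) as Ez4. pose proof (env_eps _ E4) as Ee4.
      cbn [snd] in Ez4, Ee4.
      apply (wp_seq _ _ 2), wp_block_frame with (I' := I4);
        [reflexivity|reflexivity|].
      cbn_effect. intros M5 H5.
      assert (F5 : forall r, r <> 9%nat -> r <> 10%nat -> M5 r = M4 r).
      { intros r N9 N10. rewrite H5, !updR_neq by assumption. reflexivity. }
      assert (Y9 : M5 9%nat = M4 13%nat)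
        by (rewrite H5; unfold updR; simpl; lra).
      assert (Y10 : M5 10%nat = eps)
        by (rewrite H5; unfold updR; simpl; lra).
      apply wp_while with (I := search_inv o (M 7%nat)).
      * constructor; cbn [fst snd]; rewrite ?Y9, ?Y10, ?(F5 7%nat), ?(F5 8%nat),
          ?(F5 13%nat), ?X8 by lia; auto; try lra.
        -- eapply env_frame; [exact E4|auto|].
           intros r Hr. apply F5; intros ->; discriminate Hr.
        -- unfold sound. rewrite !F5 by lia. exact Hs4.
        -- unfold argmax. rewrite !F5 by lia. exact Hmax4.
        -- intros a' t Ht.
           (* When [t] is below the best value, [a'] is within [t] of [x0], hence within the radius.
              By the Lipschitz constant 2, the maximum at [x0] is at most [t + 2 t = 3 t]. *)
           destruct (Rle_dec (M4 7%nat) t) as [Hle|Hgt]; [left; lra|right].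
           assert (Hnear : Rabs (a' - x0) <= t).
           { apply (branch_time_near v v_gt1 p0 q0 o 0 a'); [apply Ht, Hq0|].
             fold (time o 0 q0). lra. }
           destruct Hmax4 as [_ [q4 [Hq4 [Z13 _]]]].
           pose proof (branch_time_lipschitz v v_gt1 p0 q4 o x0 a') as Hlip.
           pose proof (Ht q4 Hq4) as Ht4. unfold time in *.
           split; [lra|]. apply Rmult_le_compat_r; lra.
      * intros k st Hinv Hg. destruct k as [|k].
        (* With no halving left, register 10 is at least 12, against the guard. *)
        -- exfalso. pose proof (inv_steps _ _ _ _ Hinv) as Hk. simpl in Hk.
           pose proof (env_12 _ (inv_env _ _ _ _ Hinv)).
           cbn [holds] in Hg. lra.
        -- exists k. split; [reflexivity|]. apply wp_refine, Hinv.
      * intros k [I6 M6] [E6 Hs6 Hb6 [_ [q6 [Hq6 [Z13 _]]]] Hmb6 H06 _ Hn6] Hg.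
        cbn [holds fst snd] in *.
        apply HQ; auto. intros a' t Ht.
        pose proof (ecc_le_ge0 o a' t Ht) as Ht0.
        pose proof (env_12 _ E6) as E12. cbn [snd] in E12. rewrite E12 in Hg.
        destruct (Hn6 a' t Ht) as [Hle|[Hnear Hs3]]; [nra|].
        pose proof (branch_time_lipschitz v v_gt1 p0 q6 o (M6 8%nat) a') as Hlip.
        pose proof (Ht q6 Hq6) as Ht6. unfold time in *.
        pose proof (Rabs_pos (a' - M6 8%nat)).
        (* On exit register 10 is at least 12, so the radius is at most [eps * t / 4]; the Lipschitz
           constant 2 turns this into an excess of [eps * t / 2]. *)
        assert (M6 9%nat * 12 <= M6 9%nat * M6 10%nat)
          by (apply Rmult_le_compat_l; lra).
        lra.
Qed.

Lemma wp_setup (I : nat -> Z) (M : nat -> R) (Q : state -> Prop) :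
  I 0%nat = Z.of_nat n -> M 0%nat = v -> M 1%nat = eps ->
  (forall (o : bool) i, (i < n)%nat ->
     M (2 + 2 * i + if o then 1 else 0)%nat = cx o (pt i)) ->
  (forall I' M', env (I', M') -> M' 0%nat = fst p0 -> M' 1%nat = snd p0 ->
     M' 8%nat = 0 -> Q (I', M')) ->
  wp setup (12 * n + 24) Q (I, M).
Proof.
  intros I0 M0 M1 Hpt HQ.
  apply wp_weaken with (Q := Q) (n := (11 + ((2 * n * (4 + 2) + 2) + 11))%nat);
    [|lia|auto].
  apply (wp_seq _ _ 11), wp_block; [reflexivity|].
  set (st1 := fold_left _ _ _).
  assert (X1 : fst st1 1%nat = 1%Z /\ fst st1 2%nat = Z.of_nat (base + 2 * n) /\
    fst st1 3%nat = Z.of_nat base /\ fst st1 4%nat = 2%Z /\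
    fst st1 5%nat = Z.of_nat base /\ fst st1 6%nat = 2%Z /\
    fst st1 8%nat = Z.of_nat (base - 1) /\ fst st1 9%nat = 0%Z).
  { unfold st1. cbn -[Z.add Z.sub Z.to_nat Z.of_nat base]. rewrite !I0.
    unfold base. repeat split; lia. }
  assert (Y1 : forall r, snd st1 r = updR M (base - 1) v r).
  { intros r. destruct X1 as [_ [_ [_ [_ [_ [_ [X8 _]]]]]]].
    rewrite <- M0. replace (base - 1)%nat with (Z.to_nat (fst st1 8%nat)) by lia.
    reflexivity. }
  clearbody st1. destruct X1 as [A1 [A2 [A3 [A4 [A5 [A6 [A8 A9]]]]]]].
  (* Cell 0 is the buffer of the copying loop, so [v] is saved in cell [base - 1]. Both this cell
     and the target lie beyond the input, so nothing is overwritten before it is read. *)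
  apply wp_seq, wp_while with (I := fun k st => exists j, (j + k = 2 * n)%nat /\
    (forall r, r <> 4%nat -> r <> 5%nat -> fst st r = fst st1 r) /\
    fst st 4%nat = Z.of_nat (2 + j) /\ fst st 5%nat = Z.of_nat (base + j) /\
    (forall i, (i < j)%nat -> snd st (base + i)%nat = M (2 + i)%nat) /\
    (forall i, (1 <= i < base - 1)%nat -> snd st i = M i) /\
    snd st (base - 1)%nat = v).
  - exists 0%nat. split; [lia|]. split; [auto|]. split; [rewrite A4; reflexivity|].
    split; [rewrite A5; f_equal; lia|]. split; [intros i Hi; lia|]. split.
    + intros i Hi. rewrite Y1. apply updR_neq. lia.
    + rewrite Y1. unfold updR. rewrite Nat.eqb_refl. reflexivity.
  - intros k [I' M'] [j [Hj [HI [H4 [H5 [Hc [Hl Hv]]]]]]] Hg.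
    cbn [holds fst snd] in *. rewrite (HI 2%nat), A2, H5 in Hg by lia.
    destruct k as [|k]; [lia|]. exists k. split; [reflexivity|].
    eapply wp_block_frame; [reflexivity|reflexivity|]. cbn_effect.
    rewrite H4, H5, !Nat2Z.id. intros M'' H''.
    change (updR M' 0 (M' (2 + j)%nat) 0) with (M' (2 + j)%nat) in H''.
    exists (S j); cbn [fst snd]. split; [lia|]. unfold updZ.
    split; [|split; [|split; [|split; [|split]]]].
    + intros r N4 N5. rewrite <- HI by assumption.
      apply Nat.eqb_neq in N4, N5. rewrite N5, N4. reflexivity.
    + cbn [Nat.eqb]. rewrite (HI 1%nat), A1 by lia. lia.
    + cbn [Nat.eqb]. rewrite (HI 1%nat), A1 by lia. lia.
    + intros i Hi. rewrite H''. destruct (Nat.eq_dec i j) as [->|Hne].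
      * unfold updR at 1. rewrite Nat.eqb_refl. apply Hl. unfold base. lia.
      * rewrite !updR_neq by (unfold base; lia). apply Hc. lia.
    + intros i Hi. rewrite H'', !updR_neq by lia. apply Hl, Hi.
    + rewrite H'', !updR_neq by (unfold base; lia). exact Hv.
  - intros k [I' M'] [j [Hj [HI [H4 [H5 [Hc [Hl Hv]]]]]]] Hg.
    cbn [holds fst snd] in *. rewrite (HI 2%nat), A2, H5 in Hg by lia.
    assert (Hc' : forall (o : bool) i, (i < n)%nat ->
      M' (base + 2 * i + if o then 1 else 0)%nat = cx o (pt i)).
    { intros o i Hi. rewrite <- Hpt, <- Nat.add_assoc, Hc by (destruct o; lia).
      f_equal. }
    assert (L0 : M' base = fst p0).
    { rewrite <- (Hc' false 0%nat A_nonempty : _ = fst p0). f_equal. lia. }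
    assert (L1 : M' (base + 1)%nat = snd p0).
    { rewrite <- (Hc' true 0%nat A_nonempty : _ = snd p0). f_equal. lia. }
    assert (Le : M' 1%nat = eps) by (rewrite Hl; auto; unfold base; lia).
    apply wp_block; [reflexivity|]. set (st := fold_left _ _ _).
    assert (B7 : fst st 7%nat = Z.of_nat (base + 1)).
    { unfold st. cbn -[Z.add Z.of_nat base]. rewrite !HI, A3, A1 by lia. lia. }
    assert (BI : forall r, r <> 7%nat -> fst st r = I' r).
    { intros r N7. apply Nat.eqb_neq in N7. unfold st. cbn -[Nat.eqb Z.add].
      unfold updZ. rewrite N7. reflexivity. }
    assert (P8 : Z.to_nat (I' 8%nat) = (base - 1)%nat)
      by (rewrite HI, A8 by lia; lia).
    assert (P3 : Z.to_nat (I' 3%nat) = base) by (rewrite HI, A3 by lia; lia).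
    assert (P7 : Z.to_nat (I' 3%nat + I' 1%nat) = (base + 1)%nat)
      by (rewrite !HI, A3, A1 by lia; lia).
    (* The first 13 registers are listed; the default value of [nth] covers all others, which the
       last block leaves alone. *)
    assert (BM : forall r, snd st r = nth r
      (fst p0 :: snd p0 :: v :: eps :: fst p0 :: snd p0 :: 0 :: M' 7%nat :: 0 ::
       M' 9%nat :: M' 10%nat :: 12 :: 2 :: nil) (M' r)).
    { intros r. unfold st. cbn -[Z.add Z.to_nat base].
      rewrite P8, P3, P7, !(updR_neq _ _ base), !(updR_neq _ _ (base + 1)),
        Hv, L0, L1, Le, !Rplus_0_r by (unfold base; lia).
      do 13 (destruct r as [|r]; [reflexivity|]). destruct r; reflexivity. }
    clearbody st. destruct st as [I2 M2]; cbn [fst snd] in *.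
    apply HQ; try (rewrite BM; reflexivity).
    constructor; cbn [fst snd]; rewrite ?BM; auto;
      try (rewrite BI, HI by lia; assumption).
    + intros []; rewrite BM; reflexivity.
    + intros o i Hi. rewrite BM, nth_overflow, Hc'; [reflexivity|exact Hi|].
      unfold base; simpl length; lia.
Qed.

Lemma wp_highway (N : nat) (I : nat -> Z) (M : nat -> R) :
  I 0%nat = Z.of_nat n -> M 0%nat = v -> M 1%nat = eps ->
  (forall (o : bool) i, (i < n)%nat ->
     M (2 + 2 * i + if o then 1 else 0)%nat = cx o (pt i)) ->
  12 <= 2 ^ N * eps ->
  wp highway_cmd (182 * n + 121 + N * (68 * n + 54))
    (fun st => sound (snd st) /\ forall o a t, ecc_le o a t ->
       snd st 7%nat <= (1 + eps / 2) * t) (I, M).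
Proof.
  intros I0 M0 M1 Hpt HN.
  set (Q := fun st : state => _).
  apply wp_weaken with (Q := Q) (n := ((12 * n + 24) + ((34 * n + 12) +
    (1 + ((68 * n + 42 + N * (34 * n + 27)) + (68 * n + 42 + N * (34 * n + 27))))))%nat);
    [|lia|auto].
  apply wp_seq, wp_setup; auto. intros I2 M2 E2 X0 X1 X8.
  apply wp_seq, wp_scan with (a := 0); auto. intros I3 M3 E3 F3 [Hmax _].
  pose proof (env_rzero _ E3) as Ez. cbn [snd] in Ez.
  apply (wp_seq _ _ 1), wp_block_frame with (I' := I3); [reflexivity|reflexivity|].
  cbn_effect. intros M4 H4.
  assert (F4 : forall r, r <> 7%nat -> M4 r = M3 r)
    by (intros r Hr; rewrite H4; apply updR_neq, Hr).
  assert (E4 : env (I3, M4)).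
  { eapply env_frame; [exact E3|auto|]. intros r Hr. apply F4.
    intros ->; discriminate Hr. }
  assert (S4 : sound M4).
  { exists false, 0. rewrite !F4, !F3, X0, X1 by lia. split.
    - unfold branch_cross. rewrite Rplus_0_r. reflexivity.
    - intros q Hq. rewrite H4. unfold updR; simpl. rewrite Ez, Rplus_0_r.
      apply Hmax, Hq. }
  apply wp_seq, wp_search with (N := N); auto. intros I5 M5 E5 S5 _ Hf.
  apply wp_search with (N := N); auto. intros I6 M6 E6 S6 Hle Ht.
  (* Orientation [true] is searched last; for [false], the best value has not increased since its
     own search. *)
  split; [exact S6|]. cbn [snd]. intros [] a t Hat.
  - apply (Ht a t Hat).
  - apply Rle_trans with (M5 7%nat); [exact Hle|apply (Hf a t Hat)].
Qed.

(** Comparison with an arbitrary, hence an optimal, cross: the distances from [p0] alone already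
    bound its diameter from below. *)
Lemma ecc_le_diam (H : cross) : exists o a, ecc_le o a (diam H v A).
Proof.
  destruct (travel_time_ge_branch_time v v_gt1 H p0) as [o [a Hoa]].
  exists o, a. intros q Hq. eapply Rle_trans; [apply Hoa|].
  apply le_diam; [apply pt_In; unfold n; lia|exact Hq].
Qed.

Lemma init_pt (o : bool) (i : nat) :
  rm (init_config A v eps) (2 + 2 * i + if o then 1 else 0)%nat = cx o (pt i).
Proof.
  assert (Ee : Nat.div2 (2 * i) = i) by apply Nat.div2_double.
  assert (Eo : Nat.div2 (S (2 * i)) = i) by apply Nat.div2_succ_double.
  assert (Pe : Nat.even (2 * i) = true) by (rewrite Nat.even_mul; reflexivity).
  assert (Er : forall j, rm (init_config A v eps) (S (S j)) =
    if Nat.even j then fst (pt (Nat.div2 j)) else snd (pt (Nat.div2 j)))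
    by reflexivity.
  destruct o; rewrite ?Nat.add_0_r, ?Nat.add_1_r.
  - change (S (2 + 2 * i)) with (S (S (S (2 * i)))).
    rewrite Er, Eo, Nat.even_succ, <- Nat.negb_even, Pe. reflexivity.
  - change (2 + 2 * i)%nat with (S (S (2 * i))). rewrite Er, Ee, Pe. reflexivity.
Qed.

Lemma highway_correct (N : nat) :
  12 <= 2 ^ N * eps ->
  let P := machine_of highway_cmd in
  exists k, (k <= 182 * n + 121 + N * (68 * n + 54))%nat /\
    halted P (run P k (init_config A v eps)) /\
    forall H, diam (output (run P k (init_config A v eps))) v A
              <= (2 + eps) * diam H v A.
Proof.
  intros HN P.
  set (c0 := init_config A v eps).
  destruct (wp_machine_of _ _ _ c0 eq_refl
    (wp_highway N (im c0) (rm c0) eq_refl eq_refl eq_refl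
       (fun o i _ => init_pt o i) HN))
    as [k [Hk [Hh [[o [a [Hout Ha]]] Ht]]]].
  exists k. split; [exact Hk|]. split; [exact Hh|]. intros H.
  unfold output. cbn [snd] in Hout, Ha, Ht. fold P in Hout, Ha, Ht. rewrite Hout.
  (* Joining through [p0] doubles the factor [1 + eps / 2] of the search, which gives [2 + eps]. *)
  destruct (ecc_le_diam H) as [o' [a' Hd]]. pose proof (Ht _ _ _ Hd) as Hle.
  eapply Rle_trans; [apply (diam_branch_cross v v_gt1 A p0 o a); [|exact Ha]|lra].
  exact (ecc_le_ge0 o a _ Ha).
Qed.

End Algorithm.

(** * Number of halvings and the final time bound *)

Lemma halving_count (eps : R) : 0 < eps ->
  exists N : nat, 12 <= 2 ^ N * eps /\ INR N <= 11 * Rmax 1 (ln (/ eps)).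
Proof.
  intros He. set (L := Rmax 1 (ln (/ eps))).
  assert (H1 : 1 <= L) by apply Rmax_l.
  assert (H2 : ln (/ eps) <= L) by apply Rmax_r.
  (* Since [ln 2 > 1/2] and [m + 1 > 10 L], the power [2^(m+1)] exceeds [e^(5L)]. Using [e^L >= 2]
     four times and [e^L >= 1/eps] once bounds this below by [16 / eps]. *)
  destruct (nfloor_ex (10 * L)) as [m [Hm1 Hm2]]; [lra|].
  exists (S m). rewrite S_INR. split; [|lra].
  assert (Hln2 : / 2 < ln 2) by apply ln_lt_2.
  assert (Hpow : exp (5 * L) < 2 ^ S m).
  { rewrite <- Rpower_pow, S_INR by lra. apply exp_increasing. nra. }
  assert (He1 : 2 <= exp L) by (pose proof (exp_ineq1_le L); lra).
  assert (He2 : / eps <= exp L).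
  { rewrite <- (exp_ln (/ eps)) by (apply Rinv_0_lt_compat, He).
    destruct H2 as [H2| ->]; [apply Rlt_le, exp_increasing, H2|apply Rle_refl]. }
  assert (E5 : exp (5 * L) = (exp L * exp L) * (exp L * exp L) * exp L).
  { rewrite <- !exp_plus. f_equal. lra. }
  assert (H16 : 16 * / eps <= exp (5 * L)).
  { rewrite E5. pose proof (Rinv_0_lt_compat _ He).
    assert (4 <= exp L * exp L) by nra. apply Rmult_le_compat; nra. }
  apply Rle_trans with (16 * / eps * eps); [|apply Rmult_le_compat_r; lra].
  rewrite Rmult_assoc, Rinv_l by lra. lra.
Qed.

(** [A(0,0) = 1] is below [n], so the search passes beyond 0 and this factor cannot make the time
    bound vanish. *)
Lemma inv_ack_ge1 (n : nat) : (2 <= n)%nat -> (1 <= inv_ack n)%nat.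
Proof.
  intros Hn. unfold inv_ack.
  set (go := fix go (k fuel : nat) {struct fuel} : nat := _).
  assert (Hgo : forall f k, (k <= go k f)%nat).
  { induction f as [|f IH]; intros k; simpl; [lia|].
    destruct (Nat.leb n (ack k k)); [lia|]. specialize (IH (S k)). lia. }
  change (1 <= if Nat.leb n (ack 0 0) then 0 else go 1 n)%nat.
  destruct (Nat.leb_spec n (ack 0 0)) as [H|_]; [simpl in H; lia|apply Hgo].
Qed.

Lemma ln_ge1 (x : R) : 3 <= x -> 1 <= ln x.
Proof.
  intros Hx. rewrite <- (ln_exp 1).
  apply ln_le; [apply exp_pos|pose proof exp_le_3; lra].
Qed.

(** The step count is [O(L n)], and [a] and [l], the inverse Ackermann value and the logarithm, are
    at least 1. With [L >= 1] and [n >= 3] the coefficients of [L n] add up to at most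
    [748 + 198 + 182 + 41 < 1200]. *)
Lemma time_bound (k n N L a l : R) :
  k <= 182 * n + 121 + N * (68 * n + 54) -> 3 <= n -> N <= 11 * L -> 1 <= L ->
  1 <= a -> 1 <= l -> k <= 1200 * L * a * n * l.
Proof.
  intros Hk Hn HN HL Ha Hl.
  assert (H1 : k <= 1200 * (L * n)).
  { assert (N * (68 * n + 54) <= 11 * L * (68 * n + 54))
      by (apply Rmult_le_compat_r; lra).
    nra. }
  assert (H2 : 1 <= a * l) by nra.
  assert (H3 : 0 <= L * n) by nra.
  replace (1200 * L * a * n * l) with (1200 * (L * n * (a * l))) by ring.
  assert (L * n * 1 <= L * n * (a * l)) by (apply Rmult_le_compat_l; lra).
  lra.
Qed.

Theorem theorem11 :
  exists (P : program) (C : R), 0 < C /\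
    forall (S : list point) (v eps : R),
      NoDup S -> (3 <= length S)%nat -> 1 < v -> 0 < eps ->
      exists k : nat,
        INR k <= C * Rmax 1 (ln (/ eps)) * INR (inv_ack (length S))
                   * INR (length S) * ln (INR (length S)) /\
        halted P (run P k (init_config S v eps)) /\
        forall H' : cross,
          diam (output (run P k (init_config S v eps))) v S
            <= (2 + eps) * diam H' v S.
Proof.
  exists (machine_of highway_cmd), 1200. split; [lra|].
  intros S v eps _ Hn Hv He.
  destruct (halving_count eps He) as [N [HN HNle]].
  destruct (highway_correct S v eps Hv He ltac:(lia) N HN) as [k [Hk HP]].
  exists k. split; [|exact HP].
  assert (Ha : 1 <= INR (inv_ack (length S)))
    by (apply (le_INR 1), inv_ack_ge1; lia).
  assert (Hn3 : 3 <= INR (length S)) by (apply (le_INR 3) in Hn; simpl in Hn; lra).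
  pose proof (ln_ge1 _ Hn3) as Hl.
  apply le_INR in Hk.
  (* Passing through [IZR] turns the numerals into real literals; the last rewrite restores [INR] on
     the variables. *)
  rewrite !plus_INR, !mult_INR, plus_INR, mult_INR, !INR_IZR_INZ in Hk.
  simpl Z.of_nat in Hk. rewrite <- !INR_IZR_INZ in Hk.
  apply (time_bound _ _ _ _ _ _ Hk); auto. apply Rmax_l.
Qed.
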